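(* Consider the delayed projected stochastic gradient iteration $x(t+1)=\Pi_{\mathcal S}[x(t)-\eta(t)g(t)]$ described in the context, and suppose that the Assumptions on Objective Functions, on Gradient Estimators (with bias sequence $\{q(t)\}$), and on Communication Delay (with constants $C$ and $\kappa$) stated in the context hold. Let $f$ be $\mu$-strongly convex ($\mu>0$), i.e. $f(y)\ge f(x)+\langle\nabla f(x),y-x\rangle+\frac{\mu}{2}\|y-x\|^2$ for all $x,y\in\mathcal S$, and let $x^*=\operatorname{argmin}_{x\in\mathcal S}f(x)$. If the (positive) step size sequence $\{\eta(t)\}_{t\ge0}$ is decreasing with $\lim_{t\to\infty}\frac{\eta(\lceil\kappa t\rceil)}{\eta(t)}=\bar\eta$ for some constant $\bar\eta>0$, $\sum_{t=0}^\infty\eta(t)=\infty$, $\sum_{t=0}^\infty\eta^2(t)<\infty$, and $\sum_{t=0}^\infty\eta(t)q^2(t)<\infty$, then $\lim_{t\to\infty}\mathbb E[\|x(t)-x^*\|^2]=0$. Moreover, if $\eta(t)=\frac{\eta_0}{t+1}$ for some constant $\eta_0>0$, and $q(t)=\frac{q_0}{(t+1)^\beta}$ for some constant $q_0>0$ and $\beta\ge\frac12$, then $\mathbb E[\|x(t)-x^*\|^2]=\mathcal O\left(\frac1t\right)$ as $t\to\infty$.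
   Context: Setting. Let $\mathcal S\subset\mathbb R^d$ be a closed convex set, $n\ge 1$, $f_i:\mathcal S\to\mathbb R$ for $i\in[n]=\{1,\dots,n\}$, and $f=\sum_{i=1}^n f_i$; the goal is to minimize $f$ over $\mathcal S$. $\|\cdot\|$ is the Euclidean norm, $\langle\cdot,\cdot\rangle$ the standard inner product, and $\Pi_{\mathcal S}:\mathbb R^d\to\mathcal S$ is the Euclidean projection onto $\mathcal S$. A server maintains $x(t)\in\mathcal S$, $t\in\{0,1,2,\dots\}$, with $x(0)=x_0\in\mathcal S$ arbitrary. At each time $t$ it sends $x(t)$ to all agents. Agent $i$ can return a stochastic gradient estimate $g_i(x(t),\xi(t))\in\mathbb R^d$, depending on $x(t)$ and a random variable $\xi(t)$ independent of $x(t)$. Let $\tau_i(t)\le t$ be the (random) time stamp of the latest gradient information from agent $i$ available to the server at time $t$, i.e. this information is $g_i(x(\tau_i(t)),\xi(\tau_i(t)))$; if nothing has been received from agent $i$, then $\tau_i(t)=-1$ and this term is $0$. The server forms $g(t)=\sum_{i=1}^n g_i(x(\tau_i(t)),\xi(\tau_i(t)))$ and updates $x(t+1)=\Pi_{\mathcal S}[x(t)-\eta(t)g(t)]$ with step sizes $\eta(t)>0$. Assumption on Objective Functions. $f^*:=\inf_{x\in\mathcal S}f(x)>-\infty$, $f$ is continuously differentiable, and each $f_i$ is $L$-smooth: $\|\nabla f_i(x)-\nabla f_i(y)\|\le L\|x-y\|$ for all $x,y\in\mathcal S$. Assumption on Gradient Estimators. Let $\tilde g_i(t):=\mathbb E[g_i(x(t),\xi(t))\mid\sigma(x(t))]$,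 where $\sigma(x(t))$ is the $\sigma$-algebra generated by $x(t)$. There is $G\in(0,\infty)$ such that for all $t$ and all $i\in[n]$, $\mathbb E[\|g_i(x(t),\xi(t))\|^2\mid\sigma(x(t))]\le G$. For all $t_1,t_2\in\{0,1,2,\dots\}$, $\|\tilde g_i(t_1)-\tilde g_i(t_2)\|\le L\|x(t_1)-x(t_2)\|$. Finally $\|\tilde g_i(t)-\nabla f_i(x(t))\|\le q(t)$ for a non-negative (deterministic) sequence $\{q(t)\}_{t\ge0}$, called the gradient estimator bias. Assumption on Communication Delay. The delays $t-\tau_i(t)$ are independent across time and agents. There is $0<C<\infty$ such that $\mathbb E[(t-\tau_i(t))^2]\le C$ for all $t\in\{0,1,2,\dots\}$ and $i\in[n]$. There is $\kappa\in(0,1)$ such that $t-\tau_i(t)\le(1-\kappa)t$, i.e. $\tau_i(t)\ge\kappa t$, for all $t$ and $i$.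
   Formalization: The delays are also assumed independent, as a family, of the sampling noise ξ(t), and the O(1/t) claim is stated for every η₀ > 1/(2μ) instead of every η₀ > 0; without either condition the claim fails for simple quadratics on [-1,1]. *)

(* Defs.v *)
From HB Require Import structures.
From mathcomp Require Import all_boot all_order all_algebra finmap.
From mathcomp Require Import all_classical all_reals all_analysis.

Set Implicit Arguments.
Unset Strict Implicit.
Unset Printing Implicit Defensive.
Import Order.TTheory GRing.Theory Num.Theory.
Import numFieldNormedType.Exports.
Local Open Scope classical_set_scope.
Local Open Scope ring_scope.

Section euclidean.
Context {R : realType} {d : nat}.
Implicit Types (u v x z : 'rV[R]_d) (S : set 'rV[R]_d).

Definition dot u v : R := \sum_j u 0 j * v 0 j.

(* The norm `|u| that the library puts on row vectors is the sup norm; it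
   induces the same topology but not the same projection or constants. *)
Definition enorm u : R := Num.sqrt (dot u u).

Definition euclid_proj S z : 'rV[R]_d :=
  xget z [set p | S p /\ forall y, S y -> enorm (z - p) <= enorm (z - y)].

(* Functions are only meaningful on S, so the first-order expansion at x is
   required along S only; if S is a neighbourhood of x, this is the ordinary
   (Frechet) gradient. *)
Definition has_gradient_on S (f : 'rV[R]_d -> R) x v : Prop :=
  forall eps : R, 0 < eps -> \forall y \near within S (nbhs x),
    `|f y - f x - dot v (y - x)| <= eps * enorm (y - x).

Definition gradient_on S (f : 'rV[R]_d -> R) (df : 'rV[R]_d -> 'rV[R]_d) :
    Prop :=
  forall x, S x -> has_gradient_on S f x (df x).

Definition lipschitz_grad_on S (L : R) (df : 'rV[R]_d -> 'rV[R]_d) : Prop :=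
  forall x y, S x -> S y -> enorm (df x - df y) <= L * enorm (x - y).

Definition strongly_convex_on S (mu : R) (f : 'rV[R]_d -> R)
    (df : 'rV[R]_d -> 'rV[R]_d) : Prop :=
  forall x y, S x -> S y ->
    f x + dot (df x) (y - x) + mu / 2 * enorm (y - x) ^+ 2 <= f y.

Definition is_argmin S (f : 'rV[R]_d -> R) x : Prop :=
  S x /\ forall y, S y -> f x <= f y.

End euclidean.

(* R^d with its Borel sigma-algebra. *)
Notation borel_rV R d := (g_sigma_algebraType (@open 'rV[R]_d)).

Section probability.
Context {R : realType} {dT : measure_display} {T : measurableType dT}.
Variable P : probability T R.

Definition independent (F H : set (set T)) : Prop :=
  forall A B, F A -> H B -> P (A `&` B) = (P A * P B)%E.

Definition mutually_independent {I : choiceType} (F : I -> set (set T)) :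
    Prop :=
  forall (J : {fset I}) (A : I -> set T), (forall j, j \in J -> F j (A j)) ->
    P (\bigcap_(j in [set` J]) A j) = (\prod_(j <- J) P (A j))%E.

(* V is a version of E[Y | F]. *)
Record is_cond_exp (F : set (set T)) (Y V : T -> R) : Prop := IsCondExp {
  cond_exp_integrableY : P.-integrable setT (EFin \o Y);
  cond_exp_integrableV : P.-integrable setT (EFin \o V);
  cond_exp_measurable : forall B : set R, measurable B -> F (V @^-1` B);
  cond_expE : forall A, F A ->
    (\int[P]_(w in A) (V w)%:E = \int[P]_(w in A) (Y w)%:E)%E
}.

Definition is_cond_exp_rV {d : nat} (F : set (set T)) (Y V : T -> 'rV[R]_d) :
    Prop :=
  forall j, is_cond_exp F (fun w => Y w 0 j) (fun w => V w 0 j).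

End probability.

Section delayed_sgd.
Context {R : realType} {d n : nat}.
Context {dT : measure_display} {T : measurableType dT}.
Context {dX : measure_display} {Xi : measurableType dX}.
Variable P : probability T R.

(* f_1, ..., f_n and their gradients; the gradient of the sum is the sum of
   the gradients. *)
Definition total_obj (f : 'I_n -> 'rV[R]_d -> R) (y : 'rV[R]_d) : R :=
  \sum_i f i y.

Definition total_grad (df : 'I_n -> 'rV[R]_d -> 'rV[R]_d) (y : 'rV[R]_d) :
    'rV[R]_d :=
  \sum_i df i y.

Record objective_assumption (S : set 'rV[R]_d) (f : 'I_n -> 'rV[R]_d -> R)
    (df : 'I_n -> 'rV[R]_d -> 'rV[R]_d) (L : R) : Prop :=
  ObjectiveAssumption {
  obj_bounded_below : has_lbound [set total_obj f y | y in S];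
  obj_gradient : gradient_on S (total_obj f) (total_grad df);
  obj_C1 : {within S, continuous (total_grad df)};
  obj_gradient_i : forall i, gradient_on S (f i) (df i);
  obj_smooth_i : forall i, lipschitz_grad_on S L (df i)
}.

Variable S : set 'rV[R]_d.
Variable g : 'I_n -> 'rV[R]_d -> Xi -> 'rV[R]_d.
Variable xi : nat -> T -> Xi.
Variable tau : 'I_n -> nat -> T -> int.
Variable x : nat -> T -> 'rV[R]_d.

Definition sigma_iterate (t : nat) : set (set T) :=
  g_sigma_algebra_preimage (x t : T -> borel_rV R d).

Definition sigma_noise (t : nat) : set (set T) :=
  g_sigma_algebra_preimage (xi t).

Definition delay (i : 'I_n) (t : nat) (w : T) : R :=
  (t%:Z - tau i t w)%:~R.

Definition sigma_delay (k : nat * 'I_n) : set (set T) :=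
  g_sigma_algebra_preimage (delay k.2 k.1).

Definition estimate (i : 'I_n) (t : nat) (w : T) : 'rV[R]_d :=
  g i (x t w) (xi t w).

(* A negative time stamp means that nothing has been received yet. *)
Definition stale_estimate (i : 'I_n) (t : nat) (w : T) : 'rV[R]_d :=
  match tau i t w with
  | Posz s => estimate i s w
  | Negz _ => 0
  end.

Record delayed_projected_sgd (eta : nat -> R) (x0 : 'rV[R]_d) : Prop :=
  DelayedProjectedSGD {
  noise_measurable : forall t, measurable_fun setT (xi t);
  estimator_measurable : forall i,
    measurable_fun setT
      (fun p : borel_rV R d * Xi => g i p.1 p.2 : borel_rV R d);
  delay_measurable : forall i t, measurable_fun setT (delay i t);
  noise_independent : forall t,
    independent P (sigma_noise t) (sigma_iterate t);
  stamp_bounds : forall i t w, -1 <= tau i t w <= t%:Z;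
  iterate_init : forall w, x 0%N w = x0;
  iterate_step : forall t w,
    x t.+1 w =
      euclid_proj S (x t w - eta t *: \sum_i stale_estimate i t w)
}.

Record estimator_assumption (df : 'I_n -> 'rV[R]_d -> 'rV[R]_d) (L G : R)
    (gtilde : 'I_n -> nat -> T -> 'rV[R]_d) (q : nat -> R) : Prop :=
  EstimatorAssumption {
  est_cond_mean : forall i t,
    is_cond_exp_rV P (sigma_iterate t) (estimate i t) (gtilde i t);
  est_G_gt0 : 0 < G;
  est_second_moment : forall i t, exists V : T -> R,
    is_cond_exp P (sigma_iterate t) (fun w => enorm (estimate i t w) ^+ 2) V
    /\ {ae P, forall w, V w <= G};
  est_lipschitz : forall i t1 t2, {ae P, forall w,
    enorm (gtilde i t1 w - gtilde i t2 w) <= L * enorm (x t1 w - x t2 w)};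
  est_q_ge0 : forall t, 0 <= q t;
  est_bias : forall i t, {ae P, forall w,
    enorm (gtilde i t w - df i (x t w)) <= q t}
}.

(* The delays are exogenous: besides being mutually independent they are, as a
   family, independent of the sampling noise. *)
Record delay_assumption (C kappa : R) : Prop := DelayAssumption {
  delay_mutually_independent : mutually_independent P sigma_delay;
  delay_independent_noise :
    independent P <<s \bigcup_k sigma_delay k >> <<s \bigcup_t sigma_noise t >>;
  delay_C_gt0 : 0 < C;
  delay_second_moment : forall i t,
    ('E_P[fun w => (delay i t w ^+ 2)%R] <= C%:E)%E;
  delay_kappa : 0 < kappa < 1;
  delay_bound : forall i t w, delay i t w <= (1 - kappa) * t%:R
}.

Definition mean_sq_error (xs : 'rV[R]_d) (t : nat) : \bar R :=
  'E_P[fun w => (enorm (x t w - xs) ^+ 2)%R]%E.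

End delayed_sgd.

(* Main.v *)
(* Expanding |x(t+1) - x*|^2 by nonexpansiveness of the projection leaves the
   drift E<g_i(x(tau),xi(tau)), x(t) - x*>.  Every iterate x(s) with s <= t is
   measurable with respect to the noise and the delays of the rounds before t,
   hence independent of tau_i(t), so the drift is the average of
   E<g_i(x(s),xi(s)), x(t) - x*> over the law of tau_i(t).  Conditioning on
   x(s) and the Lipschitz property of the conditional means replace
   g_i(x(s),xi(s)) by its conditional mean at time t at a cost controlled by
   E|x(t) - x(s)|^2 <= (t-s)^2 h^2 n^2 G, where h bounds the step sizes after
   kappa t; the second moment of the delay makes this cost O(h + h^2).  Strong
   convexity then gives
     a(t+1) <= (1 - 2 (mu - delta) eta(t)) a(t)
               + K (eta(t) h + eta(t) h^2 + eta(t) q(t)^2 + eta(t)^2)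
   for a(t) = E|x(t) - x*|^2 and any delta > 0, and both claims are
   consequences of this real recursion. *)
Require Import Defs.
From mathcomp Require Import all_boot all_order all_algebra finmap.
From mathcomp Require Import all_classical all_reals all_analysis.
From mathcomp Require Import measurable_realfun ring lra.
Import Order.TTheory GRing.Theory Num.Theory.
Import numFieldNormedType.Exports.
Local Open Scope classical_set_scope.
Local Open Scope ring_scope.

(** * Euclidean geometry and projections *)

(** The estimator is unbiased up to [q] only conditionally on the single iterate x(s), not on the
    history. A stale estimate can therefore be conditioned only when paired with a function of x(s),
    so x(t) - x* is exchanged for x(s) - x* and back; these exchanges cost the first-order term in
    [h], while comparing the conditional means costs only h^2. Instead of a filtration, one
    pi-system per round holds the earlier delays and the noise of all rounds, and its independence
    of tau_i(t) spreads by Dynkin's theorem. The margin [delta] pays for Young's inequality, whose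
    [eps] part falls on a(t). For convergence delta = mu/2 is enough: the bound kappa t <= tau and
    the limit of eta(ceil(kappa t))/eta(t) make [h] comparable to eta(t), so the errors are
    summable. The rate needs 2 (mu - delta) eta0 > 1, because a(t+1) = (1 - p/(t+1)) a(t) with p < 1
    decays only like t^-p; hence the hypothesis on [eta0] and a [delta] that depends on it. *)

Section euclid.
Context {R : realType} {d : nat}.
Implicit Types (u v w x y z : 'rV[R]_d) (S : set 'rV[R]_d).

Lemma dotC u v : dot u v = dot v u.
Proof. by apply: eq_bigr => j _; rewrite mulrC. Qed.

Lemma dotDl u v w : dot (u + v) w = dot u w + dot v w.
Proof. by rewrite -big_split; apply: eq_bigr => j _; rewrite mxE mulrDl. Qed.

Lemma dotDr u v w : dot w (u + v) = dot w u + dot w v.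
Proof. by rewrite dotC dotDl !(dotC w). Qed.

Lemma dotZl a u v : dot (a *: u) v = a * dot u v.
Proof. by rewrite /dot mulr_sumr; apply: eq_bigr => j _; rewrite mxE mulrA. Qed.

Lemma dotZr a u v : dot u (a *: v) = a * dot u v.
Proof. by rewrite dotC dotZl dotC. Qed.

Lemma dotNl u v : dot (- u) v = - dot u v.
Proof. by rewrite -scaleN1r dotZl mulN1r. Qed.

Lemma dotNr u v : dot u (- v) = - dot u v.
Proof. by rewrite dotC dotNl dotC. Qed.

Lemma dotBl u v w : dot (u - v) w = dot u w - dot v w.
Proof. by rewrite dotDl dotNl. Qed.

Lemma dotBr u v w : dot w (u - v) = dot w u - dot w v.
Proof. by rewrite dotDr dotNr. Qed.

Lemma dot0l u : dot 0 u = 0.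
Proof. by rewrite -(scale0r 0) dotZl mul0r. Qed.

Lemma dot_suml (I : Type) (r : seq I) (Q : pred I) (F : I -> 'rV[R]_d) v :
  dot (\sum_(i <- r | Q i) F i) v = \sum_(i <- r | Q i) dot (F i) v.
Proof.
by apply: (big_morph (fun u => dot u v)) => [? ?|]; rewrite ?dotDl ?dot0l.
Qed.

Lemma dot_ge0 u : 0 <= dot u u.
Proof. by apply: sumr_ge0 => j _; rewrite -expr2 sqr_ge0. Qed.

Lemma sqr_enorm u : enorm u ^+ 2 = dot u u.
Proof. by rewrite sqr_sqrtr ?dot_ge0. Qed.

Lemma enorm_ge0 u : 0 <= enorm u.
Proof. exact: sqrtr_ge0. Qed.

Lemma ler_enorm u v : (enorm u <= enorm v) = (dot u u <= dot v v).
Proof. by rewrite /enorm ler_sqrt ?dot_ge0. Qed.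

(** Expand the square of [c *: u - v] and divide by [c]. The free weight decides which side absorbs
    a cross term, and stands in for Cauchy-Schwarz in the sequel. *)
Lemma dot_young (c : R) u v : 0 < c ->
  2 * dot u v <= c * dot u u + c^-1 * dot v v.
Proof.
move=> c0; have := dot_ge0 (c *: u - v).
rewrite dotBl !dotBr !dotZl !dotZr (dotC v u) => h.
rewrite -subr_ge0 -(pmulr_rge0 _ c0).
rewrite mulrBr mulrDr (mulrA c c^-1) divff ?gt_eqF// mul1r; lra.
Qed.

Lemma dotD_le u v : dot (u + v) (u + v) <= 2 * dot u u + 2 * dot v v.
Proof.
have := dot_young 1 u v ltr01.
rewrite dotDl !dotDr (dotC v u) invr1 !mul1r; lra.
Qed.

(** Together with [dot_le_normr] this compares the sup norm, which carries the topology, with the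
    Euclidean norm, which carries the estimates. *)
Lemma normr_le_dot u : `|u| ^+ 2 <= dot u u.
Proof.
have [->|un0] := eqVneq `|u| 0; first by rewrite expr0n/= dot_ge0.
have [[i j] e] : exists i, mx_norm u = `|u i.1 i.2|.
  by apply: mx_norm_neq0.
rewrite (_ : `|u| = mx_norm u) ?e ?real_normK ?num_real//.
rewrite /dot (bigD1 j)//= ord1 expr2 lerDl.
by apply: sumr_ge0 => k _; rewrite -expr2 sqr_ge0.
Qed.

Lemma coord_le_norm u j : `|u 0 j| <= `|u|.
Proof.
rewrite -[leRHS]/(mx_norm u) mx_normrE; apply/bigmax_geP; right => /=.
by exists (0, j).
Qed.

Lemma dot_le_normr u : dot u u <= d%:R * `|u| ^+ 2.
Proof.
rewrite -[X in X%:R]card_ord -sum1_card natr_sum mulr_suml.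
apply: ler_sum => j _; rewrite mul1r -expr2 -real_normK ?num_real//.
by rewrite lerXn2r ?nnegrE// coord_le_norm.
Qed.

Lemma continuous_coord (j : 'I_d) :
  continuous (fun y : 'rV[R]_d => y 0 j).
Proof. exact: coord_continuous. Qed.

Lemma continuous_sqdist z : continuous (fun y => dot (z - y) (z - y)).
Proof.
have h j : continuous (fun y : 'rV[R]_d => (z - y) 0 j).
  have -> : (fun y : 'rV[R]_d => (z - y) 0 j) =
            cst (z 0 j) \- (fun y : 'rV[R]_d => y 0 j).
    by apply/funext => y; rewrite !mxE.
  by move=> y; apply: continuousB; [exact: cst_continuous|exact: continuous_coord].
apply: (@continuous_big R^o _ +%R 0 xpredT) => [|j _ y].
  exact: add_continuous.
by apply: continuousM; exact: h.
Qed.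

Lemma convex_segment S x y (t : R) : convex_set S -> S x -> S y ->
  0 <= t <= 1 -> S (x + t *: (y - x)).
Proof.
move=> cS Sx Sy /andP[t0 t1].
have h : Itv.spec (@Itv.num_sem R) (Itv.Real `[0%Z, 1%Z]) t.
  by apply/andP; split; rewrite ?num_real//= in_itv/= t0 t1.
have := cS y x (Itv.mk h) (mem_set Sy) (mem_set Sx) => /set_mem.
rewrite /conv/=; congr S.
apply/rowP => k; rewrite !mxE /= /unstable.onem; ring.
Qed.

Definition sqdist_min S z p :=
  S p /\ forall y, S y -> enorm (z - p) <= enorm (z - y).

(** Only points at least as close to [z] as some fixed [x0] compete; they form a compact set, on
    which the continuous squared distance attains its minimum. *)
Lemma sqdist_min_exists S z : closed S -> S !=set0 -> exists p, sqdist_min S z p.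
Proof.
move=> cS [x0 Sx0].
pose f y := dot (z - y) (z - y).
pose A := S `&` [set y | f y <= f x0].
have clA : closed A.
  apply: closedI => //; apply: (preimage_closed _ (@closed_le _ (f x0))) => y _.
  exact: continuous_sqdist.
have bA : bounded_set A.
  (* For s = |z - y|, (s - 1)^2 >= 0 and s^2 <= f x0 give s <= 1 + f x0 without a square root. *)
  exists (`|z| + (1 + f x0)); split; first exact: num_real.
  move=> M hM y [_ /= hy]; apply/ltW/(le_lt_trans _ hM).
  rewrite (_ : y = z - (z - y)); last by rewrite subKr.
  apply: (le_trans (ler_normB _ _)); rewrite lerD2l.
  have h := le_trans (normr_le_dot (z - y)) hy.
  have f0 : 0 <= f x0 := dot_ge0 _.
  have := sqr_ge0 (`|z - y| - 1); rewrite sqrrB1 => h2.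
  have {}h : `|z - y| ^+ 2 <= f x0 by [].
  lra.
have cA := bounded_closed_compact bA clA.
have [||p pA hp] := @EVT_min_rV _ _ f A _ cA.
- by exists x0; split => //=.
- by apply: continuous_subspaceT; exact: continuous_sqdist.
move: pA; rewrite inE => -[Sp hp0]; exists p; split => // y Sy.
rewrite ler_enorm; have [h|h] := leP (f y) (f x0).
  by apply: hp; rewrite inE.
by apply: (le_trans hp0); exact: ltW.
Qed.

(** Moving from [p] towards [y] by a fraction [t] stays in [S] and cannot reduce the distance, so 2
    a <= t b for all t in (0, 1]; small [t] then excludes a > 0. *)
Lemma sqdist_min_variational S z p y : convex_set S -> sqdist_min S z p -> S y ->
  dot (z - p) (y - p) <= 0.
Proof.
move=> cS [Sp hp] Sy; rewrite leNgt; apply/negP => h.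
set a := dot (z - p) (y - p) in h; set b := dot (y - p) (y - p).
have b0 : 0 <= b := dot_ge0 _.
have key t : 0 < t -> t <= 1 -> 2 * a <= t * b.
  move=> t0 t1; have /hp : S (p + t *: (y - p)).
    by apply: convex_segment; rewrite ?(ltW t0).
  rewrite ler_enorm opprD addrA /a /b; move: (z - p) (y - p) => u v.
  rewrite dotBl !dotBr !dotZl !dotZr (dotC v) => hh.
  rewrite -(ler_pM2l t0); lra.
have ab : 0 < a + b by rewrite ltr_wpDr.
(* This [t] lies in (0, 1] even if b = 0, and turns the bound into 2 a (a + b) <= a b, impossible
   for a > 0. *)
have := key (a / (a + b)); rewrite divr_gt0// ler_pdivrMr// mul1r lerDl b0.
move=> /(_ isT isT); rewrite mulrAC ler_pdivlMr// => hh.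
have := mulr_ge0 (ltW h) b0; have := mulr_gt0 h h; lra.
Qed.

Lemma euclid_projP S z : closed S -> S !=set0 -> sqdist_min S z (euclid_proj S z).
Proof.
move=> cS S0; have [p hp] := sqdist_min_exists S z cS S0.
exact: (@xgetI _ z _ p).
Qed.

(** Adding the variational inequalities at the two projections p, r gives |p - r|^2 <= <y - z, p -
    r>; expanding |(y - z) - (p - r)|^2 >= 0 finishes. *)
Lemma euclid_proj_contract S y z : closed S -> convex_set S -> S !=set0 ->
  dot (euclid_proj S y - euclid_proj S z) (euclid_proj S y - euclid_proj S z)
  <= dot (y - z) (y - z).
Proof.
move=> cS vS S0.
have hy := euclid_projP S y cS S0; have hz := euclid_projP S z cS S0.
have h1 := sqdist_min_variational _ _ _ (euclid_proj S z) vS hy hz.1.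
have h2 := sqdist_min_variational _ _ _ (euclid_proj S y) vS hz hy.1.
have := dot_ge0 ((y - z) - (euclid_proj S y - euclid_proj S z)).
move: h1 h2; move: (euclid_proj S y) (euclid_proj S z) => p r.
rewrite !(dotBl, dotBr) (dotC r p) (dotC z y) (dotC p y) (dotC p z).
rewrite (dotC r y) (dotC r z); lra.
Qed.

Lemma euclid_proj_id S z : closed S -> convex_set S -> S z -> euclid_proj S z = z.
Proof.
move=> cS vS Sz; have [|h1 h2] := euclid_projP S z cS; first by exists z.
have := h2 _ Sz; rewrite ler_enorm subrr dot0l => h.
have : `|z - euclid_proj S z| ^+ 2 <= 0 by apply: le_trans h; exact: normr_le_dot.
by rewrite exprn_even_le0//= normr_eq0 subr_eq0 => /eqP <-.
Qed.

Lemma continuous_euclid_proj S : closed S -> convex_set S -> S !=set0 ->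
  continuous (euclid_proj S).
Proof.
move=> cS vS S0 z; apply/(@cvgrPdist_lt _ _ _ _ (nbhs_filter z)) => e e0.
near=> y.
have h := le_trans (normr_le_dot _) (euclid_proj_contract S z y cS vS S0).
have {h} := le_trans h (dot_le_normr _) => h.
(* The factor d + 1 is positive also for d = 0, and its square dominates the constant [d] of
   [dot_le_normr]. *)
have hy : d.+1%:R * `|z - y| < e.
  rewrite -ltr_pdivlMl//; near: y; apply: cvgr_dist_lt => //.
  by rewrite mulr_gt0// invr_gt0.
rewrite -(@ltr_pXn2r _ 2) ?nnegrE//; last exact: ltW.
apply: (le_lt_trans h); apply: (@le_lt_trans _ _ ((d.+1%:R * `|z - y|) ^+ 2)).
  rewrite exprMn ler_wpM2r ?sqr_ge0// -natrX ler_nat.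
  by rewrite (leq_trans (leqnSn d))// leq_pmulr.
by rewrite ltr_pXn2r ?nnegrE// ?mulr_ge0// ltW.
Unshelve. all: by end_near. Qed.

(** Induction on the list: the cross term between the head and the sum of a tail of length k is
    split by Young with weight k, which makes the constants add up to exactly k + 1. The singleton
    is treated apart so that k > 0. *)
Lemma dot_sum_le (I : Type) (r : seq I) (F : I -> 'rV[R]_d) :
  dot (\sum_(i <- r) F i) (\sum_(i <- r) F i)
  <= (size r)%:R * \sum_(i <- r) dot (F i) (F i).
Proof.
elim: r => [|i r IH]; first by rewrite !big_nil dot0l mul0r.
rewrite !big_cons /=; case: r IH => [|j r] IH.
  by rewrite !big_nil !addr0 mul1r.
move: IH; rewrite [size _]/=.
set s := \sum_(i <- j :: r) _; set k : R := (size r).+1%:R.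
set q := \sum_(i <- j :: r) _ => IH.
have k0 : 0 < k by rewrite ltr0n.
have := dot_young k (F i) s k0.
have hs : k^-1 * dot s s <= q by rewrite ler_pdivrMl.
have -> : (size r).+2%:R = k + 1 by rewrite natr1.
rewrite dotDl !dotDr (dotC s (F i)); move: (k^-1 * _) hs => z hs; nra.
Qed.

(** Strong convexity at a point z of the segment, taken towards both ends with weights [t] and
    [1 - t], cancels the slope term at z. Minimality of [xs] then enters only as f xs <= f z, and t
    -> 0 gives the claim. *)
Lemma strongly_convex_gap S mu f df xs x : convex_set S -> 0 < mu ->
  strongly_convex_on S mu f df -> is_argmin S f xs -> S x ->
  f xs + mu / 2 * dot (x - xs) (x - xs) <= f x.
Proof.
move=> vS mu0 sc [Sxs hmin] Sx.
set D := dot (x - xs) (x - xs); have D0 : 0 <= D := dot_ge0 _.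
set e := mu / 2 * D.
have key t : 0 < t -> t <= 1 -> (1 - t) * e <= f x - f xs.
  move=> t0 t1; pose z := xs + t *: (x - xs).
  have Sz : S z by apply: convex_segment; rewrite ?(ltW t0).
  have := sc z x Sz Sx; have := sc z xs Sz Sxs; have := hmin z Sz.
  rewrite !sqr_enorm.
  have -> : x - z = (1 - t) *: (x - xs) by apply/rowP => k; rewrite !mxE; ring.
  have -> : xs - z = - t *: (x - xs) by apply/rowP => k; rewrite !mxE; ring.
  rewrite !(dotZl, dotZr) -/D; set g := dot (df z) _ => h0 h1 h2.
  rewrite -(ler_pM2l t0).
  have h3 : t * (f z + (1 - t) * g + mu / 2 * ((1 - t) * ((1 - t) * D))) <= t * f x.
    by rewrite ler_pM2l.
  have h4 : (1 - t) * (f z + - t * g + mu / 2 * (- t * (- t * D))) <= (1 - t) * f xs.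
    by rewrite ler_wpM2l// subr_ge0.
  rewrite /e; lra.
have e0 : 0 <= e by rewrite mulr_ge0// divr_ge0// ltW.
have d0 : f xs <= f x := hmin x Sx.
rewrite leNgt; apply/negP => hlt.
have e1 : 0 < e by lra.
have e2 : 0 < 2 * e by lra.
(* With this [t], (1 - t) e is the midpoint of e and f x - f xs, hence still above f x - f xs. *)
have t0 : 0 < (e - (f x - f xs)) / (2 * e).
  by rewrite divr_gt0// subr_gt0; lra.
have t1 : (e - (f x - f xs)) / (2 * e) <= 1.
  by rewrite ler_pdivrMr//; lra.
have := key _ t0 t1; rewrite mulrBl mul1r.
have : (e - (f x - f xs)) / (2 * e) * e = (e - (f x - f xs)) / 2.
  by field; rewrite gt_eqF.
lra.
Qed.

(** One half of [mu] comes from strong convexity at [x], the other from the gap. The full constant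
    matters for the threshold on [eta0]. *)
Lemma strongly_convex_dot S mu f df xs x : convex_set S -> 0 < mu ->
  strongly_convex_on S mu f df -> is_argmin S f xs -> S x ->
  mu * dot (x - xs) (x - xs) <= dot (df x) (x - xs).
Proof.
move=> vS mu0 sc am Sx.
have := strongly_convex_gap _ _ _ _ _ _ vS mu0 sc am Sx.
have := sc x xs Sx am.1.
rewrite sqr_enorm -(opprB x xs) !(dotNl, dotNr); lra.
Qed.

End euclid.

(** * Integrable random variables *)

Section integrability.
Context {R : realType} {dT : measure_display} {T : measurableType dT}.
Variable P : probability T R.
Implicit Types (X Y Z : T -> R) (A : set T).

Definition summable_rv X : Prop := P.-integrable setT (EFin \o X).

Definition sqint X : Prop :=
  measurable_fun setT X /\ summable_rv (fun w => X w ^+ 2).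

Lemma summable_meas X : summable_rv X -> measurable_fun setT X.
Proof. by move=> /integrableP[/measurable_EFinP]. Qed.

Lemma summableD X Y : summable_rv X -> summable_rv Y ->
  summable_rv (fun w => X w + Y w).
Proof. by move=> hX hY; exact: (integrableD measurableT hX hY). Qed.

Lemma summableZ c X : summable_rv X -> summable_rv (fun w => c * X w).
Proof. by move=> hX; exact: (integrableZl measurableT c hX). Qed.

Lemma summableB X Y : summable_rv X -> summable_rv Y ->
  summable_rv (fun w => X w - Y w).
Proof. by move=> hX hY; exact: (integrableB measurableT hX hY). Qed.

Lemma summable_cst c : summable_rv (fun=> c).
Proof. exact: finite_measure_integrable_cst. Qed.

Lemma summable_sum (I : Type) (r : seq I) (F : I -> T -> R) :
  (forall i, summable_rv (F i)) -> summable_rv (fun w => \sum_(i <- r) F i w).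
Proof.
move=> hF; elim: r => [|i r IH].
  by under [X in summable_rv X]eq_fun do rewrite big_nil; exact: summable_cst.
by under [X in summable_rv X]eq_fun do rewrite big_cons; exact: summableD.
Qed.

Lemma le_summable X Y : measurable_fun setT X -> (forall w, `|X w| <= Y w) ->
  summable_rv Y -> summable_rv X.
Proof.
move=> mX XY hY; apply: (le_integrable measurableT _ _ hY).
  exact/measurable_EFinP.
by move=> w _ /=; rewrite lee_fin (le_trans (XY w))// ler_norm.
Qed.

Lemma RintD X Y : summable_rv X -> summable_rv Y ->
  \int[P]_w (X w + Y w) = \int[P]_w X w + \int[P]_w Y w.
Proof. exact: RintegralD. Qed.

Lemma RintB X Y : summable_rv X -> summable_rv Y ->
  \int[P]_w (X w - Y w) = \int[P]_w X w - \int[P]_w Y w.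
Proof. exact: RintegralB. Qed.

Lemma RintZ c X : summable_rv X ->
  \int[P]_w (c * X w) = c * \int[P]_w X w.
Proof. exact: RintegralZl. Qed.

Lemma Rint_cst c : \int[P]_w (fun=> c) w = c.
Proof. by rewrite Rintegral_cst//= probability_setT mulr1. Qed.

Lemma Rint_sum (I : Type) (r : seq I) (F : I -> T -> R) :
  (forall i, summable_rv (F i)) ->
  \int[P]_w (\sum_(i <- r) F i w) = \sum_(i <- r) \int[P]_w F i w.
Proof.
move=> hF; elim: r => [|i r IH].
  by under eq_Rintegral do rewrite big_nil; rewrite big_nil (Rint_cst 0).
under eq_Rintegral do rewrite big_cons; rewrite big_cons RintD ?IH//.
exact: summable_sum.
Qed.

Lemma Rint_ge0 X : summable_rv X -> {ae P, forall w, 0 <= X w} ->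
  0 <= \int[P]_w X w.
Proof.
move=> hX X0; have mX := summable_meas _ hX.
(* The sign is known only almost surely; the absolute value has the same integral and is nonnegative
   everywhere. *)
have -> : \int[P]_w X w = \int[P]_w `|X w|.
  congr fine; apply: ae_eq_integral => //=.
  - exact/measurable_EFinP.
  - by apply/measurable_EFinP; exact: measurableT_comp.
  - by apply: filterS X0 => w h _; rewrite ger0_norm.
exact: Rintegral_ge0.
Qed.

Lemma le_Rint X Y : summable_rv X -> summable_rv Y ->
  {ae P, forall w, X w <= Y w} -> \int[P]_w X w <= \int[P]_w Y w.
Proof.
move=> hX hY XY; rewrite -subr_ge0 -RintB//; apply: Rint_ge0.
  exact: summableB.
by apply: filterS XY => w; rewrite subr_ge0.
Qed.

Lemma EFin_Rint X : summable_rv X -> 'E_P[X]%E = (\int[P]_w X w)%:E.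
Proof. by move=> hX; rewrite unlock /Rintegral fineK//; exact: integrable_fin_num. Qed.

Lemma sqint_mul X Y : sqint X -> sqint Y -> summable_rv (fun w => X w * Y w).
Proof.
move=> [mX hX] [mY hY]; apply: le_summable (summableD _ _ hX hY).
  exact: measurable_funM.
move=> w; rewrite normrM -(real_normK (num_real (X w))) -(real_normK (num_real (Y w))).
have := sqr_ge0 (`|X w| - `|Y w|); have := sqr_ge0 (`|X w| + `|Y w|).
by rewrite sqrrB sqrrD; lra.
Qed.

Lemma sqintD X Y : sqint X -> sqint Y -> sqint (fun w => X w + Y w).
Proof.
move=> hX hY; split; first exact: measurable_funD hX.1 hY.1.
have -> : (fun w => (X w + Y w) ^+ 2) =
          (fun w => (X w ^+ 2 + 2 * (X w * Y w)) + Y w ^+ 2).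
  by apply/funext => w; ring.
by apply: summableD hY.2; apply: summableD hX.2 _; apply: summableZ; exact: sqint_mul.
Qed.

Lemma sqint_cst c : sqint (fun=> c).
Proof. by split; [exact: measurable_cst|exact: summable_cst]. Qed.

Lemma sqintZ c X : sqint X -> sqint (fun w => c * X w).
Proof.
move=> [mX hX]; split; first exact: measurable_funM (measurable_cst _) mX.
by under [X in summable_rv X]eq_fun do rewrite exprMn; exact: summableZ.
Qed.

Lemma measurable_indicM A X : measurable A -> measurable_fun setT X ->
  measurable_fun setT (fun w => \1_A w * X w).
Proof. by move=> mA mX; apply: measurable_funM => //; exact: measurable_indic. Qed.

Lemma normr_indicM A X w : `|\1_A w * X w| <= `|X w|.
Proof. by rewrite indicE; case: (w \in A); rewrite ?mul1r// mul0r normr0. Qed.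

Lemma summable_indic A X : measurable A -> summable_rv X ->
  summable_rv (fun w => \1_A w * X w).
Proof.
move=> mA hX; apply: (@le_summable _ (fun w => `|X w|)).
- by apply: measurable_indicM => //; exact: summable_meas.
- by move=> w; exact: normr_indicM.
- exact: (integrable_abse hX).
Qed.

Lemma sqint_indic A X : measurable A -> sqint X ->
  sqint (fun w => \1_A w * X w).
Proof.
move=> mA [mX hX]; split; first exact: measurable_indicM.
apply: le_summable hX; first by apply/measurable_funX/measurable_indicM.
move=> w; rewrite normrX -[leRHS]real_normK ?num_real//.
by rewrite lerXn2r ?nnegrE// normr_indicM.
Qed.

Lemma Rint_indic A X : measurable A -> summable_rv X ->
  \int[P]_w (\1_A w * X w) = \int[P]_(w in A) X w.
Proof.
move=> mA hX; rewrite [RHS]Rintegral_mkcond; apply: eq_Rintegral => w _.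
by rewrite patchE indicE; case: (w \in A); rewrite ?mul1r ?mul0r.
Qed.

Import HBNNSimple.

(* If E[D; Z in B] = 0 for all Borel B then E[D h(Z)] = 0 for simple h, and
   dominated convergence along a simple approximation of the positive part
   concludes. *)
Lemma Rint_mul_preimage0_ge0 D Z (phi : R -> R) :
  measurable_fun setT Z -> measurable_fun setT phi -> (forall r, 0 <= phi r) ->
  summable_rv D -> summable_rv (fun w => D w * phi (Z w)) ->
  (forall B, measurable B -> \int[P]_w (\1_(Z @^-1` B) w * D w) = 0) ->
  \int[P]_w (D w * phi (Z w)) = 0.
Proof.
move=> mZ mphi phi0 hD hDZ h.
have mphiE : measurable_fun setT (EFin \o phi) by exact/measurable_EFinP.
(* Approximating [phi] on the real line, before composing with [Z], makes every level set the
   preimage under [Z] of a Borel set, where [h] applies. *)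
pose a := nnsfun_approx measurableT mphiE.
have ha n w : D w * a n (Z w) = \sum_(i < #|` fset_set (range (a n))|)
    (fset_set (range (a n)))`_i *
    (\1_(Z @^-1` (a n @^-1` [set (fset_set (range (a n)))`_i])) w * D w).
  rewrite [X in D w * X](fimfunEord (a n)) mulr_sumr; apply: eq_bigr => i _.
  by rewrite mulrCA (mulrC (D w)).
have mB n i : measurable (Z @^-1` (a n @^-1` [set (fset_set (range (a n)))`_i])).
  by rewrite -[X in measurable X]setTI; apply: mZ.
have int_a n : \int[P]_w (D w * a n (Z w)) = 0.
  under eq_Rintegral do rewrite ha.
  rewrite Rint_sum => [|i]; last by apply: summableZ; exact: summable_indic.
  rewrite big1// => i _; rewrite RintZ; last exact: summable_indic.
  by rewrite h ?mulr0.
have le_a n w : `|D w * a n (Z w)| <= `|D w * phi (Z w)|.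
  rewrite !normrM ler_wpM2l// ger0_norm ?fun_ge0// ger0_norm// -lee_fin.
  have phiE0 r : [set: R] r -> (0 <= (EFin \o phi) r)%E by rewrite lee_fin.
  by rewrite nnsfun_approxE; exact: le_approx.
have := @dominated_cvg _ _ _ P setT measurableT
  (fun n w => (D w * a n (Z w))%:E) (fun w => (D w * phi (Z w))%:E)
  (fun w => `|D w * phi (Z w)|%:E).
have cvg0 : (fun n => \int[P]_w (D w * a n (Z w))%:E)%E = cst 0%E.
  apply/funext => n /=; rewrite -(@fineK _ (\int[P]_w _)%E).
    by congr EFin; exact: int_a.
  apply: integrable_fin_num => //.
  under eq_fun do rewrite ha.
  apply: summable_sum => i; apply: summableZ; exact: summable_indic.
rewrite cvg0 => /(_ _ _ _ _ _)/cvg_lim => H.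
rewrite /Rintegral -H ?lim_cst//.
- move=> n; apply/measurable_EFinP/measurable_funM; first exact: summable_meas.
  by apply: measurableT_comp.
- move=> w _; apply: cvg_EFin.
    by near=> n.
  apply: cvgMr.
  have := @cvg_nnsfun_approx _ _ _ setT measurableT _ mphiE _ (Z w) I.
  by move=> /(_ (fun r _ => phi0 r)) /fine_cvg.
- exact: (integrable_abse hDZ).
- by move=> n w _ /=; rewrite lee_fin.
Unshelve. all: by end_near. Qed.

Lemma Rint_mul_preimage0 D Z : measurable_fun setT Z ->
  summable_rv D -> summable_rv (fun w => D w * Z w) ->
  (forall B, measurable B -> \int[P]_w (\1_(Z @^-1` B) w * D w) = 0) ->
  \int[P]_w (D w * Z w) = 0.
Proof.
move=> mZ hD hDZ h.
pose p (r : R) := Num.max r 0; pose m (r : R) := Num.max (- r) 0.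
have E r : r = p r - m r.
  rewrite /p /m; have [r0|r0] := lerP 0 r.
    by rewrite (max_r (_ : - r <= 0)) ?oppr_le0// subr0.
  by rewrite (max_l (_ : 0 <= - r)) ?oppr_ge0 ?ltW// sub0r opprK.
have mp : measurable_fun setT p by apply: measurable_maxr.
have mm : measurable_fun setT m by apply: measurable_maxr => //; exact: measurable_oppr.
have p0 r : 0 <= p r by rewrite le_max lexx orbT.
have m0 r : 0 <= m r by rewrite le_max lexx orbT.
have pr r : p r <= `|r| by rewrite ge_max ler_norm normr_ge0.
have mr r : m r <= `|r| by rewrite ge_max -normrN ler_norm normr_ge0.
have hp : summable_rv (fun w => D w * p (Z w)).
  apply: (@le_summable _ (fun w => `|D w * Z w|)).
  - by apply: measurable_funM; [exact: summable_meas|exact: measurableT_comp].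
  - by move=> w; rewrite !normrM ler_wpM2l// ger0_norm.
  - exact: (integrable_abse hDZ).
have hm : summable_rv (fun w => D w * m (Z w)).
  apply: (@le_summable _ (fun w => `|D w * Z w|)).
  - by apply: measurable_funM; [exact: summable_meas|exact: measurableT_comp].
  - by move=> w; rewrite !normrM ler_wpM2l// ger0_norm.
  - exact: (integrable_abse hDZ).
transitivity (\int[P]_w (D w * p (Z w) - D w * m (Z w))).
  by apply: eq_Rintegral => w _; rewrite -mulrBr -E.
by rewrite RintB// !(@Rint_mul_preimage0_ge0 D Z)// subr0.
Qed.

(** Common source of conditioning, where [V] is a conditional expectation of [X], and of
    independence, where [X] is an indicator and [V] the constant probability. *)
Lemma Rint_mul_preimage X V Z : measurable_fun setT Z ->
  summable_rv X -> summable_rv V ->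
  summable_rv (fun w => X w * Z w) -> summable_rv (fun w => V w * Z w) ->
  (forall B, measurable B ->
    \int[P]_(w in Z @^-1` B) X w = \int[P]_(w in Z @^-1` B) V w) ->
  \int[P]_w (X w * Z w) = \int[P]_w (V w * Z w).
Proof.
move=> mZ hX hV hXZ hVZ h; apply/eqP; rewrite -subr_eq0 -RintB//; apply/eqP.
under eq_Rintegral do rewrite -mulrBl.
apply: (@Rint_mul_preimage0 (fun w => X w - V w)) => //; first exact: summableB.
  by under [X in summable_rv X]eq_fun do rewrite mulrBl; exact: summableB.
move=> B mB; have mZB : measurable (Z @^-1` B).
  by rewrite -[X in measurable X]setTI; exact: mZ.
under eq_Rintegral do rewrite mulrBr.
by rewrite RintB ?Rint_indic ?h ?subrr//; exact: summable_indic.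
Qed.

Lemma Rint_cond_exp (F : set (set T)) X V Z :
  F `<=` measurable -> is_cond_exp P F X V ->
  (forall B, measurable B -> F (Z @^-1` B)) ->
  summable_rv (fun w => X w * Z w) -> summable_rv (fun w => V w * Z w) ->
  \int[P]_w (X w * Z w) = \int[P]_w (V w * Z w).
Proof.
move=> mF [hX hV _ hE] FZ hXZ hVZ.
apply: (@Rint_mul_preimage X V Z) => //.
  by move=> _ B mB; rewrite setTI; exact/mF/FZ.
by move=> B mB; rewrite /Rintegral hE//; exact: FZ.
Qed.

Lemma Rint_independent A Y : measurable A -> summable_rv Y ->
  (forall B, measurable B -> (P (A `&` Y @^-1` B) = P A * P (Y @^-1` B))%E) ->
  \int[P]_w (\1_A w * Y w) = fine (P A) * \int[P]_w Y w.
Proof.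
move=> mA hY ind; rewrite -RintZ//.
have mY := summable_meas _ hY.
(* Independence says that the indicator of [A] and the constant P(A) have equal integrals over each
   event of sigma(Y). *)
apply: (@Rint_mul_preimage \1_A (cst (fine (P A))) Y) => //.
- exact: integrable_indic.
- exact: summable_cst.
- exact: summable_indic.
- exact: summableZ.
move=> B mB; have mYB : measurable (Y @^-1` B).
  by rewrite -[X in measurable X]setTI; exact: mY.
rewrite Rintegral_cst// /Rintegral integral_indic//.
by rewrite [X in fine X]ind// fineM//; exact: fin_num_measure.
Qed.

End integrability.

(** * Random vectors *)

Section borel_rV.
Context {R : realType} {d : nat} {d1 : measure_display} {T1 : measurableType d1}.
Implicit Types Y : T1 -> 'rV[R]_d.

(** An open set is the countable union of the rational boxes inside it, and the preimage of a box is
    a finite intersection of coordinate events. Boxes that stick out are given [set0], so that the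
    union can run over a whole countable type. *)
Lemma borel_rV_measurable Y :
  (forall j, measurable_fun setT (fun w => Y w 0 j)) ->
  measurable_fun setT (Y : T1 -> borel_rV R d).
Proof.
move=> mY; apply: (@measurability _ _ T1 (borel_rV R d) setT Y (@open 'rV[R]_d)) => //.
move=> _ [U oU <-]; rewrite setTI.
pose rd (k : nat) : R := k.+1%:R^-1.
pose box (c : 'rV[rat]_d) (k : nat) : set 'rV[R]_d :=
  [set y | forall j, `|y 0 j - ratr (c 0 j)| < rd k].
pose W (ck : 'rV[rat]_d * nat) : set T1 :=
  if `[< box ck.1 ck.2 `<=` U >] then Y @^-1` box ck.1 ck.2 else set0.
have -> : Y @^-1` U = \bigcup_ck W ck.
  apply/seteqP; split=> [w /= Uw|w [[c k] _]]; last first.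
    by rewrite /W; case: asboolP => //= h; exact: h.
  have /nbhs_ballP[e /= e0 be] : nbhs (Y w) U by exact: open_nbhs_nbhs.
  have [k hk] : exists k, rd k < e / 2.
    have e20 : 0 < e / 2 by rewrite divr_gt0.
    have [k _ /(_ k (leqnn k)) hk] := near_infty_natSinv_lt (PosNum e20).
    by exists k; exact: hk.
  have rk0 : 0 < rd k by rewrite invr_gt0.
  have hc j : exists q : rat, `|Y w 0 j - ratr q| < rd k.
    have [q hq] := @rat_in_itvoo R (Y w 0 j - rd k) (Y w 0 j + rd k) ltac:(lra).
    by exists q; move: hq; rewrite in_itv/= distrC ltr_distl.
  have [c Hc] := choice hc.
  exists (\row_j c j, k) => //; rewrite /W /= asboolT; last first.
    move=> z hz; apply: be; rewrite -ball_normE /=.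
    (* The sup norm is known to be attained at a coordinate only when it is nonzero; the split also
       covers d = 0. *)
    have [->|n0] := eqVneq `|Y w - z| 0; first by [].
    have [[i j] h] : exists i, mx_norm (Y w - z) = `|(Y w - z) i.1 i.2|.
      by apply: mx_norm_neq0.
    rewrite (_ : `|_| = mx_norm (Y w - z)) ?h//= ord1 !mxE.
    have := hz j; rewrite mxE; have := Hc j => h1 h2.
    rewrite (_ : _ - _ = (Y w 0 j - ratr (c j)) - (z 0 j - ratr (c j))); last by ring.
    apply: (le_lt_trans (ler_normB _ _)); lra.
  by move=> j; rewrite mxE.
apply: countable_bigcupT_measurable => // -[c k].
rewrite /W; case: asboolP => // _ /=.
have -> : Y @^-1` box c k =
    \bigcap_(j in [set: 'I_d]) [set w | `|Y w 0 j - ratr (c 0 j)| < rd k].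
  by apply/seteqP; split=> w /= h j => [_|]; apply: h.
apply: fin_bigcap_measurable => // j _.
have mf : measurable_fun setT (fun w => `|Y w 0 j - ratr (c 0 j)|).
  by apply: measurableT_comp => //; exact: measurable_funB.
have := mf measurableT _ (measurable_itv `]-oo, rd k[); rewrite setTI.
by congr measurable; apply/seteqP; split=> w /=; rewrite in_itv.
Qed.

Lemma measurable_borel_rV Y j : measurable_fun setT (Y : T1 -> borel_rV R d) ->
  measurable_fun setT (fun w => Y w 0 j).
Proof.
move=> mY.
suff mj : measurable_fun setT ((fun y => y 0 j) : borel_rV R d -> R).
  exact: (measurableT_comp mj mY).
apply: (measurability _ (RGenOpens.measurableE R)) => _ [_ [a [b ->]] <-].
rewrite setTI; apply: sub_sigma_algebra.
apply: (@open_comp _ _ (fun y : 'rV[R]_d => y 0 j)); last exact: interval_open.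
by move=> y _; exact: continuous_coord.
Qed.

Lemma measurable_euclid_proj (S : set 'rV[R]_d) Y :
  closed S -> convex_set S -> S !=set0 ->
  measurable_fun setT (Y : T1 -> borel_rV R d) ->
  measurable_fun setT ((fun w => euclid_proj S (Y w)) : T1 -> borel_rV R d).
Proof.
move=> cS vS S0 mY.
suff mp : measurable_fun setT (euclid_proj S : borel_rV R d -> borel_rV R d).
  exact: (measurableT_comp mp mY).
apply: (@measurability _ _ (borel_rV R d) (borel_rV R d) setT _ (@open 'rV[R]_d)) => //.
move=> _ [U oU <-]; rewrite setTI; apply: sub_sigma_algebra.
by apply: open_comp => // y _; exact: continuous_euclid_proj.
Qed.

End borel_rV.

(** * Independence and generating pi-systems *)

Section generated.
Context {R : realType} {dT : measure_display} {T : measurableType dT}.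
Variable P : probability T R.

Lemma g_sigma_measurable_fun d1 (U : measurableType d1) (G : set (set T))
    (f : T -> U) :
  G `<=` measurable ->
  measurable_fun setT (f : g_sigma_algebraType G -> U) ->
  measurable_fun setT f.
Proof.
move=> GT mf _ B mB; rewrite setTI.
have := mf measurableT B mB; rewrite setTI.
apply: (@smallest_sub _ _ _ (@measurable _ T)) => //.
exact: sigma_algebra_measurable.
Qed.

(** Dynkin's theorem: the events independent of [A] contain the whole space and are stable under
    complements and countable disjoint unions. *)
Lemma independent_generated (A : set T) (G : set (set T)) :
  measurable A -> setI_closed G -> G `<=` measurable ->
  (forall B, G B -> (P (A `&` B) = P A * P B)%E) ->
  forall B, <<s G >> B -> (P (A `&` B) = P A * P B)%E.
Proof.
move=> mA GI GT ind.
have sGT : <<s G >> `<=` measurable.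
  by apply: smallest_sub => //; exact: sigma_algebra_measurable.
apply: (@dynkin_induction _ (g_sigma_algebraType G) G
  [set B | (P (A `&` B) = P A * P B)%E]) => //=.
- by rewrite setIT probability_setT mule1.
- move=> B mB h; have mB' : measurable (B : set T) by exact: sGT.
  have e : (P (A `\` B) = P A - P (A `&` B))%E.
    by apply: measureD => //; rewrite ltey_eq fin_num_measure.
  rewrite -setDE e h probability_setC// muleBr ?mule1//.
  exact: fin_num_measure.
- move=> F mF tF h; rewrite setI_bigcupr.
  have mF' k : measurable (F k : set T) by apply: sGT; exact: mF.
  have e1 : (P (\bigcup_k (A `&` F k)) = \sum_(0 <= k <oo) P (A `&` F k))%E.
    apply: measure_semi_bigcup => //.
    - by move=> k; exact: measurableI.
    - exact: trivIset_setIl.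
    - by apply: bigcup_measurable => k _; exact: measurableI.
  have e2 : (P (\bigcup_k F k) = \sum_(0 <= k <oo) P (F k))%E.
    by apply: measure_semi_bigcup => //; exact: bigcup_measurable.
  rewrite e1 e2; under eq_eseriesr do rewrite h.
  rewrite -[P A]fineK; last exact: fin_num_measure.
  by rewrite nneseriesZl// fineK// fin_num_measure.
Qed.

Lemma Rint_independent_generated (A : set T) (G : set (set T)) (Y : T -> R) :
  measurable A -> setI_closed G -> G `<=` measurable ->
  (forall B, G B -> (P (A `&` B) = P A * P B)%E) ->
  measurable_fun setT (Y : g_sigma_algebraType G -> R) ->
  summable_rv P Y ->
  \int[P]_w (\1_A w * Y w) = fine (P A) * \int[P]_w Y w.
Proof.
move=> mA GI GT ind mY hY; apply: Rint_independent => // B mB.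
apply: (@independent_generated _ G) => //.
by have := mY measurableT B mB; rewrite setTI.
Qed.

End generated.

(** * Square-integrable random vectors *)

Section square_integrable_vectors.
Context {R : realType} {d : nat} {dT : measure_display} {T : measurableType dT}.
Variable P : probability T R.
Implicit Types (U V W : T -> 'rV[R]_d) (A : set T).

Definition vsqint U : Prop := forall j, sqint P (fun w => U w 0 j).

Lemma vsqintD U V : vsqint U -> vsqint V -> vsqint (fun w => U w + V w).
Proof.
move=> hU hV j; under [X in sqint _ X]eq_fun do rewrite mxE.
exact: sqintD.
Qed.

Lemma vsqintZ c U : vsqint U -> vsqint (fun w => c *: U w).
Proof.
move=> hU j; under [X in sqint _ X]eq_fun do rewrite mxE.
exact: sqintZ.
Qed.

Lemma vsqintB U V : vsqint U -> vsqint V -> vsqint (fun w => U w - V w).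
Proof.
move=> hU hV; under [X in vsqint X]eq_fun do rewrite -scaleN1r.
by apply: vsqintD => //; exact: vsqintZ.
Qed.

Lemma vsqint_cst c : vsqint (fun=> c).
Proof. by move=> j; exact: sqint_cst. Qed.

Lemma vsqint_sum (I : Type) (r : seq I) (F : I -> T -> 'rV[R]_d) :
  (forall i, vsqint (F i)) -> vsqint (fun w => \sum_(i <- r) F i w).
Proof.
move=> hF; elim: r => [|i r IH].
  by under [X in vsqint X]eq_fun do rewrite big_nil; exact: vsqint_cst.
by under [X in vsqint X]eq_fun do rewrite big_cons; exact: vsqintD.
Qed.

Lemma vsqint_indic A U : measurable A -> vsqint U -> vsqint (fun w => \1_A w *: U w).
Proof.
move=> mA hU j; under [X in sqint _ X]eq_fun do rewrite mxE.
exact: sqint_indic.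
Qed.

Lemma summable_dot U V : vsqint U -> vsqint V -> summable_rv P (fun w => dot (U w) (V w)).
Proof. by move=> hU hV; apply: summable_sum => j; exact: sqint_mul. Qed.

(** The bound is allowed to fail on a null set because the bias bound on [gtilde] holds only almost
    surely. *)
Lemma le_vsqint U (Y : T -> R) :
  (forall j, measurable_fun setT (fun w => U w 0 j)) ->
  summable_rv P Y -> {ae P, forall w, dot (U w) (U w) <= Y w} -> vsqint U.
Proof.
move=> mU hY UY j; split => //.
have mU2 : measurable_fun setT (EFin \o (fun w => U w 0 j ^+ 2)).
  by apply/measurable_EFinP; exact: measurable_funX.
apply/integrableP; split => //.
have /integrableP[mY] := integrable_abse hY; apply: le_lt_trans.
apply: ae_ge0_le_integral => //=.
- by apply/measurable_EFinP/measurableT_comp => //; exact: measurable_funX.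
- apply/measurable_EFinP; do 2 apply: measurableT_comp => //.
  exact: summable_meas hY.
apply: filterS UY => w h _; rewrite lee_fin normr_id.
rewrite ger0_norm ?sqr_ge0//; apply: le_trans (le_trans h (ler_norm _)).
rewrite /dot (bigD1 j)//= expr2 lerDl; apply: sumr_ge0 => k _.
by rewrite -expr2 sqr_ge0.
Qed.

Lemma Rint_young c U V : 0 < c -> vsqint U -> vsqint V ->
  2 * \int[P]_w dot (U w) (V w) <=
  c * \int[P]_w dot (U w) (U w) + c^-1 * \int[P]_w dot (V w) (V w).
Proof.
move=> c0 hU hV; rewrite -!RintZ; try exact: summable_dot.
rewrite -RintD; try by apply: summableZ; exact: summable_dot.
apply: le_Rint; first by apply: summableZ; exact: summable_dot.
  by apply: summableD; apply: summableZ; exact: summable_dot.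
by apply: nearW => w; exact: dot_young.
Qed.

Lemma Rint_sqr_ge0 U : 0 <= \int[P]_w dot (U w) (U w).
Proof. by apply: Rintegral_ge0 => w _; exact: dot_ge0. Qed.

Lemma Rint_cond_exp_dot (F : set (set T)) U V W :
  F `<=` measurable -> is_cond_exp_rV P F U V ->
  (forall j B, measurable B -> F ((fun w => W w 0 j) @^-1` B)) ->
  vsqint U -> vsqint V -> vsqint W ->
  \int[P]_w dot (U w) (W w) = \int[P]_w dot (V w) (W w).
Proof.
move=> mF UV FW hU hV hW; rewrite /dot.
rewrite !Rint_sum; try by move=> j; exact: sqint_mul.
apply: eq_bigr => j _; apply: (Rint_cond_exp _ _ _ _ _ mF (UV j) (FW j));
  exact: sqint_mul.
Qed.

(* The projection [V] of [U] satisfies E<U,V> = E<V,V>, so that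
   0 <= E|U - V|^2 = E|U|^2 - E|V|^2. *)
Lemma Rint_cond_exp_sqr_le (F : set (set T)) U V :
  F `<=` measurable -> is_cond_exp_rV P F U V -> vsqint U -> vsqint V ->
  \int[P]_w dot (V w) (V w) <= \int[P]_w dot (U w) (U w).
Proof.
move=> mF UV hU hV.
have e : \int[P]_w dot (U w) (V w) = \int[P]_w dot (V w) (V w).
  apply: (@Rint_cond_exp_dot F) => // j B mB.
  exact: (cond_exp_measurable (UV j)).
have := Rint_young _ _ _ ltr01 hU hV; rewrite e invr1; lra.
Qed.

End square_integrable_vectors.

(** * Real recursions *)

Section real_sequences.
Context {R : realType}.
Implicit Types a e eta u : nat -> R.

Lemma bounded_nneseries u : (forall t, 0 <= u t) ->
  (\sum_(0 <= t <oo) (u t)%:E < +oo)%E ->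
  exists M, forall t, \sum_(0 <= s < t) u s <= M.
Proof.
move=> u0 hu; exists (fine (\sum_(0 <= t <oo) (u t)%:E)%E) => t.
have uE0 s : (0 <= (u s)%:E)%E by rewrite lee_fin.
rewrite -lee_fin fineK; last first.
  by rewrite ge0_fin_numE//; apply: nneseries_ge0.
rewrite -sumEFin; apply: (nneseries_lim_ge t) => s _ _; exact: uE0.
Qed.

Lemma unbounded_nneseries u M : (forall t, 0 <= u t) ->
  (\sum_(0 <= t <oo) (u t)%:E = +oo)%E ->
  exists t, M < \sum_(0 <= s < t) u s.
Proof.
move=> u0 hu; apply/not_existsP => h.
have : (\sum_(0 <= t <oo) (u t)%:E <= M%:E)%E.
  apply: lime_le; first by apply: is_cvg_nneseries => s _ _; rewrite lee_fin.
  apply: nearW => t; rewrite sumEFin lee_fin leNgt; apply/negP; exact: h.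
by rewrite hu leye_eq.
Qed.

(** Subtracting the partial sums of [e] leaves a nonincreasing sequence bounded below, so [a]
    converges. A positive limit would make each step lose a fixed multiple of [eta], which bounds
    the sum of the [eta t]. The factor [1 - c * eta t] may be negative. *)
Lemma recursion_cvg0 a eta e c M : 0 < c ->
  (forall t, 0 <= a t) -> (forall t, 0 <= eta t) -> (forall t, 0 <= e t) ->
  (forall t, a t.+1 <= (1 - c * eta t) * a t + e t) ->
  (forall t, \sum_(0 <= s < t) e s <= M) ->
  (forall B, exists t, B < \sum_(0 <= s < t) eta s) ->
  a @ \oo --> (0 : R).
Proof.
move=> c0 a0 eta0 e0 rec heM heta.
pose S t := \sum_(0 <= s < t) e s.
have cS : cvgn S.
  apply: nondecreasing_is_cvgn.
    by apply/nondecreasing_seqP => t; rewrite /S big_nat_recr//= lerDl.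
  by exists M => _ [t _ <-]; exact: heM.
pose V t := a t - S t.
have VS t : V t.+1 <= V t - c * eta t * a t.
  by rewrite /V /S big_nat_recr//= -/(S t); have := rec t; lra.
have Vlb t : - M <= V t by have := heM t; have := a0 t; rewrite /V -/(S t); lra.
have cV : cvgn V.
  apply: nonincreasing_is_cvgn.
    apply/nonincreasing_seqP => t; apply: (le_trans (VS t)).
    by rewrite gerBl !mulr_ge0// ltW.
  by exists (- M) => _ [t _ <-]; exact: Vlb.
have aE : a = V \+ S by apply/funext => t; rewrite /V /= subrK.
have ca : cvgn a by rewrite aE; exact: is_cvgD.
have l0 : 0 <= limn a by apply: limr_ge => //; exact: nearW.
suff -> : (0 : R) = limn a by [].
apply/eqP; rewrite eq_le l0 /= leNgt; apply/negP => lp.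
have lh : limn a / 2 < limn a by lra.
have [N _ hN] := cvgr_gt _ ca _ lh.
have hsum t : c * (limn a / 2) * \sum_(N <= s < N + t) eta s <= V N - V (N + t)%N.
  elim: t => [|t IH]; first by rewrite addn0 big_geq// mulr0 subrr.
  rewrite addnS big_nat_recr/= ?leq_addr// mulrDr.
  have h1 := VS (N + t)%N.
  have h2 : c * (limn a / 2) * eta (N + t)%N <= c * eta (N + t)%N * a (N + t)%N.
    rewrite mulrAC ler_wpM2l ?mulr_ge0 ?(ltW c0)// ltW//.
    by apply: hN => /=; exact: leq_addr.
  lra.
have k0 : 0 < c * (limn a / 2) by rewrite mulr_gt0// divr_gt0.
(* The level is the sum before [N] plus the most that the total drop V N + M allows afterwards. *)
have [t ht] := heta (\sum_(0 <= s < N) eta s + (c * (limn a / 2))^-1 * (V N + M)).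
have htN : \sum_(0 <= s < t) eta s <= \sum_(0 <= s < N + t) eta s.
  rewrite (@big_cat_nat _ _ _ t 0 (N + t))//= ?leq_addl// lerDl.
  by apply: sumr_ge0 => s _.
have := hsum t; rewrite -ler_pdivlMl// => h.
have hB : (c * (limn a / 2))^-1 * (V N - V (N + t)%N) <=
    (c * (limn a / 2))^-1 * (V N + M).
  by rewrite ler_wpM2l ?invr_ge0 ?(ltW k0)//; have := Vlb (N + t)%N; lra.
move: htN; rewrite (@big_cat_nat _ _ _ N 0 (N + t))//= ?leq_addr//; lra.
Qed.

(** The comparison of [h] with [eta t] holds only eventually, so the recursion is available only
    from some [N] on. *)
Lemma recursion_shift_cvg0 a eta e c M N : 0 < c ->
  (forall t, 0 <= a t) -> (forall t, 0 <= eta t) -> (forall t, 0 <= e t) ->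
  (forall t, (N <= t)%N -> a t.+1 <= (1 - c * eta t) * a t + e t) ->
  (forall t, \sum_(0 <= s < t) e s <= M) ->
  (forall B, exists t, B < \sum_(0 <= s < t) eta s) ->
  a @ \oo --> (0 : R).
Proof.
move=> c0 a0 eta0 e0 rec heM heta.
have shiftE (u : nat -> R) t : \sum_(0 <= s < t) u (s + N)%N =
    \sum_(0 <= s < N + t) u s - \sum_(0 <= s < N) u s.
  rewrite (@big_cat_nat _ _ _ N 0 (N + t))//= ?leq_addr// addrC addrK.
  by rewrite -{2}[N]add0n big_addn addKn.
rewrite -(cvg_shiftn N).
apply: (@recursion_cvg0 (fun t => a (t + N)%N) (fun t => eta (t + N)%N)
  (fun t => e (t + N)%N) c M) => //.
- by move=> t /=; rewrite addSn; apply: rec; rewrite leq_addl.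
- move=> t; rewrite shiftE lerBlDr; apply: (le_trans (heM _)).
  by rewrite lerDl sumr_ge0.
- move=> B; have [t ht] := heta (B + \sum_(0 <= s < N) eta s).
  exists t; rewrite shiftE ltrBrDr; apply: (lt_le_trans ht).
  by rewrite (@big_cat_nat _ _ _ t 0 (N + t))//= ?leq_addl// lerDl sumr_ge0.
Qed.

(** Induction on a t <= K'/t from a rank [m] above [p], where the factor 1 - p/(t+1) is nonnegative.
    In [K'], the term K/(p - 1) makes the induction step work and m a(m) starts it. *)
Lemma recursion_rate a p K : 1 < p -> 0 <= K -> (forall t, 0 <= a t) ->
  (forall t, a t.+1 <= (1 - p / t.+1%:R) * a t + K / t.+1%:R ^+ 2) ->
  exists K', \forall t \near \oo, a t <= K' / t%:R.
Proof.
move=> p1 K0 a0 rec; have p10 : 0 < p - 1 by rewrite subr_gt0.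
pose m := (Num.bound p).+1.
have pm : p <= m%:R.
  apply: (le_trans (ltW (archi_boundP _))); first lra.
  by rewrite ler_nat.
pose K' := Num.max (K / (p - 1)) (m%:R * a m).
have hK : K <= K' * (p - 1).
  by rewrite -ler_pdivrMr// /K' le_max lexx.
have hm : m%:R * a m <= K' by rewrite /K' le_max lexx orbT.
have K'0 : 0 <= K' by apply: le_trans hm; rewrite mulr_ge0.
exists K'; exists m => // t /= mt.
rewrite -(subnK mt); move: (t - m)%N => {mt}t.
elim: t => [|t IH]; first by rewrite add0n ler_pdivlMr ?ltr0n// mulrC.
rewrite addSn; move: IH; set s := (t + m)%N => IH.
have x0 : 0 < s%:R :> R by rewrite ltr0n /s addnS.
have px : p <= s.+1%:R.
  by apply: (le_trans pm); rewrite ler_nat /s (leq_trans _ (leqnSn _))// leq_addl.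
have y0 : 0 < s.+1%:R :> R by rewrite ltr0n.
apply: (le_trans (rec s)).
have q0 : 0 <= 1 - p / s.+1%:R by rewrite subr_ge0 ler_pdivrMr// mul1r.
(* Weakening (s+1)^2 to s (s+1) gives all terms one denominator, and leaves exactly K' (p - 1) - K
   as numerator. *)
apply: (@le_trans _ _ ((1 - p / s.+1%:R) * (K' / s%:R) + K / (s%:R * s.+1%:R))).
  apply: lerD; first by rewrite ler_wpM2l.
  rewrite ler_wpM2l// lef_pV2 ?posrE ?mulr_gt0 ?exprn_gt0// expr2.
  by rewrite ler_wpM2r ?(ltW y0)// ler_nat.
have e : K' / s.+1%:R - ((1 - p / s.+1%:R) * (K' / s%:R) + K / (s%:R * s.+1%:R)) =
    (K' * (p - 1) - K) / (s%:R * s.+1%:R).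
  rewrite -natr1; field; rewrite natr1 !gt_eqF//.
by rewrite -subr_ge0 e divr_ge0 ?subr_ge0// mulr_ge0 ?ltW.
Qed.

(** Arithmetic of one iteration: [e] is the step size, [I] the drift, [B] the second moment of the
    server gradient and [r] the bias. The errors in [I] are halved because the drift is multiplied
    by 2 e. *)
Lemma recursion_step (s' s e I B K1 K2 K3 K4 h r mu delta : R) :
  0 <= e -> 0 <= h -> 0 <= K1 -> 0 <= K2 -> 0 <= K3 -> 0 <= K4 ->
  s' <= s - 2 * e * I + e ^+ 2 * B -> B <= K4 ->
  mu * s - delta * s - (K1 * h + K2 * h ^+ 2 + K3 * r ^+ 2) / 2 <= I ->
  s' <= (1 - 2 * (mu - delta) * e) * s
    + (K1 + K2 + K3 + K4) * (e * h + e * h ^+ 2 + e * r ^+ 2 + e ^+ 2).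
Proof.
move=> e0 h0 K10 K20 K30 K40 hs hB hI.
have p1 : 0 <= e * h by rewrite mulr_ge0.
have p2 : 0 <= e * h ^+ 2 by rewrite mulr_ge0 ?sqr_ge0.
have p3 : 0 <= e * r ^+ 2 by rewrite mulr_ge0 ?sqr_ge0.
have p4 := sqr_ge0 e.
have h1 : K1 * (e * h) + K2 * (e * h ^+ 2) + K3 * (e * r ^+ 2) + K4 * e ^+ 2
    <= (K1 + K2 + K3 + K4) * (e * h + e * h ^+ 2 + e * r ^+ 2 + e ^+ 2).
  move: p1 p2 p3 p4.
  move: (e * h) (e * h ^+ 2) (e * r ^+ 2) (e ^+ 2) => x1 x2 x3 x4 p1 p2 p3 p4.
  rewrite [leRHS]mulrDr; apply: lerD; last by rewrite ler_wpM2r//; lra.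
  rewrite [leRHS]mulrDr; apply: lerD; last by rewrite ler_wpM2r//; lra.
  rewrite [leRHS]mulrDr; apply: lerD; by rewrite ler_wpM2r//; lra.
apply: le_trans (lerD (lexx _) h1); apply: (le_trans hs).
have hB2 := ler_wpM2l p4 hB; have hI2 := ler_wpM2l e0 hI.
lra.
Qed.

End real_sequences.

(** * The delayed iteration *)

Section history.
Context {R : realType} {d n : nat}.
Context {dT : measure_display} {T : measurableType dT} (P : probability T R).
Context {dX : measure_display} {Xi : measurableType dX}.
Context (S : set 'rV[R]_d) (S_closed : closed S) (S_convex : convex_set S).
Context (g : 'I_n -> 'rV[R]_d -> Xi -> 'rV[R]_d).
Context (xi : nat -> T -> Xi) (tau : 'I_n -> nat -> T -> int).
Context (x : nat -> T -> 'rV[R]_d) (eta : nat -> R) (x0 : 'rV[R]_d).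
Context (C kappa : R) (x0_in : S x0).
Context (process : delayed_projected_sgd P S g xi tau x eta x0).
Context (delays : delay_assumption P xi tau C kappa).

Notation sdelay := (@sigma_delay R n dT T tau).
Notation delayed := (@delay R n dT T tau).

(** A finite index set, since mutual independence is a statement about finite families. *)
Definition past_fset (t : nat) : {fset nat * 'I_n} :=
  [fset k in [seq (r, i) | r <- iota 0 t, i <- enum 'I_n]]%fset.

Lemma in_past_fset t k : (k \in past_fset t) = (k.1 < t)%N.
Proof.
rewrite inE /=; apply/allpairsP/idP => [[[r i] /= [+ _ ->]]|kt].
  by rewrite mem_iota.
exists k; split; rewrite ?mem_iota ?mem_enum//; by case: k kt.
Qed.

Definition noise_system : set (set T) := <<s \bigcup_t sigma_noise xi t >>.

(* The past of the process before the delays of round [t] are drawn: the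
   delays of the rounds [r < t] together with the whole sampling noise. *)
Definition past_system (t : nat) : set (set T) :=
  [set B | exists A : nat * 'I_n -> set T, exists N : set T,
    [/\ forall k, sdelay k (A k), noise_system N
      & B = (\bigcap_(k in [set` past_fset t]) A k) `&` N]].

Lemma sdelayT k : sdelay k setT.
Proof. by exists setT => //; rewrite setTI preimage_setT. Qed.

Lemma sdelayI k A B : sdelay k A -> sdelay k B -> sdelay k (A `&` B).
Proof.
move=> [A' mA <-] [B' mB <-]; exists (A' `&` B'); first exact: measurableI.
by rewrite !setTI preimage_setI.
Qed.

Lemma sdelay_measurable k A : sdelay k A -> measurable A.
Proof. by move=> [B mB <-]; apply: (delay_measurable process). Qed.

Lemma noise_systemT : noise_system setT.
Proof.
exact: (@measurableT _ (g_sigma_algebraType (\bigcup_t sigma_noise xi t))).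
Qed.

Lemma noise_systemI : setI_closed noise_system.
Proof.
move=> A B mA mB.
exact: (@measurableI _ (g_sigma_algebraType (\bigcup_t sigma_noise xi t))).
Qed.

Lemma noise_system_measurable : noise_system `<=` measurable.
Proof.
apply: smallest_sub; first exact: sigma_algebra_measurable.
move=> _ [t _ [B mB <-]]; exact: (noise_measurable process t).
Qed.

Lemma past_systemI t : setI_closed (past_system t).
Proof.
move=> _ _ [A [N [hA hN ->]]] [A' [N' [hA' hN' ->]]].
exists (fun k => A k `&` A' k), (N `&` N'); split.
- by move=> k; exact: sdelayI.
- exact: noise_systemI.
- by rewrite bigcapI setIACA.
Qed.

Lemma past_bigcap_measurable t A : (forall k, sdelay k (A k)) ->
  measurable (\bigcap_(k in [set` past_fset t]) A k).
Proof.
move=> hA; apply: fin_bigcap_measurable; first exact: finite_fset.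
by move=> k _; exact: sdelay_measurable (hA k).
Qed.

Lemma past_system_measurable t : past_system t `<=` measurable.
Proof.
move=> _ [A [N [hA hN ->]]]; apply: measurableI; first exact: past_bigcap_measurable.
exact: noise_system_measurable.
Qed.

Lemma past_system_delay t k A : (k.1 < t)%N -> sdelay k A -> past_system t A.
Proof.
move=> kt hA; exists (fun l => if l == k then A else setT), setT; split.
- by move=> l; case: eqP => [->//|_]; exact: sdelayT.
- exact: noise_systemT.
- rewrite setIT; apply/seteqP; split=> [w Aw l _|w]; first by case: eqP.
  by move=> /(_ k); rewrite eqxx; apply; rewrite /= in_past_fset.
Qed.

Lemma past_system_noise t N : noise_system N -> past_system t N.
Proof.
move=> hN; exists (fun=> setT), N; split => //; first by move=> k; exact: sdelayT.
rewrite (_ : \bigcap_(k in _) _ = setT) ?setTI//.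
by apply/seteqP; split.
Qed.

(** Independence of delays and noise splits off the noise event, once with [A0] and once without;
    mutual independence of the delays then separates [A0] from the earlier ones, (t, i) being a
    fresh index. *)
Lemma past_system_independent t i A0 B : sdelay (t, i) A0 -> past_system t B ->
  (P (A0 `&` B) = P A0 * P B)%E.
Proof.
move=> hA0 [A [N [hA hN ->]]].
set D := \bigcap_(k in _) _.
have mind := delay_mutually_independent delays.
have sub k A1 : sdelay k A1 -> <<s \bigcup_k sdelay k >> A1.
  by move=> h; apply: sub_sigma_algebra; exists k.
have sD : <<s \bigcup_k sdelay k >> D.
  apply: (@fin_bigcap_measurable _ (g_sigma_algebraType (\bigcup_k sdelay k))).
    exact: finite_fset.
  by move=> k _; exact: sub (hA k).
have sAD : <<s \bigcup_k sdelay k >> (A0 `&` D).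
  apply: (@measurableI _ (g_sigma_algebraType (\bigcup_k sdelay k))) => //.
  exact: sub hA0.
have PD : P D = (\prod_(k <- past_fset t) P (A k))%E by exact: mind.
have tiN : (t, i) \notin past_fset t by rewrite in_past_fset ltnn.
have PAD : (P (A0 `&` D) = P A0 * P D)%E.
  (* The family [A] also has a value at (t, i), irrelevant to [D]; it is overwritten by [A0]. *)
  pose A' k := if k == (t, i) then A0 else A k.
  have hA' k : sdelay k (A' k) by rewrite /A'; case: eqP => [->|].
  have := mind ((t, i) |` past_fset t)%fset A' (fun k _ => hA' k).
  have A'ti : A' (t, i) = A0 by rewrite /A' eqxx.
  rewrite big_fsetU1//= A'ti.
  have A'E k : k \in past_fset t -> A' k = A k.
    by rewrite /A'; case: eqP => // -> kp; rewrite kp in tiN.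
  rewrite (eq_big_seq (fun k => P (A k))); last by move=> k /A'E ->.
  rewrite -PD => <-; congr (P _).
  apply/seteqP; split=> [w [A0w Dw] k /=|w h].
    rewrite in_fset1U => /orP[/eqP ->|kp]; first by rewrite A'ti.
    by rewrite A'E//; exact: Dw.
  split; first by rewrite -A'ti; apply: h; rewrite /= in_fset1U eqxx.
  by move=> k /= kp; rewrite -A'E//; apply: h; rewrite /= in_fset1U kp orbT.
rewrite setIA (delay_independent_noise delays sAD hN).
by rewrite (delay_independent_noise delays sD hN) PAD muleA.
Qed.

Notation pastType t := (g_sigma_algebraType (past_system t)).

(** The case s = t is essential: an estimate stamped [t] uses [xi t] and must still be independent
    of the delay of round [t]. *)
Lemma noise_past_measurable t s : measurable_fun setT (xi s : pastType t -> Xi).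
Proof.
move=> _ B mB; apply: sub_sigma_algebra; apply: past_system_noise.
by apply: sub_sigma_algebra; exists s => //; exists B.
Qed.

Definition stamp_set (i : 'I_n) (t s : nat) : set T := [set w | tau i t w = s%:Z].

Lemma stamp_set_sdelay i t s : sdelay (t, i) (stamp_set i t s).
Proof.
exists [set (t%:Z - s%:Z)%:~R]; first exact: measurable_set1.
rewrite setTI; apply/seteqP; split=> w /=; rewrite /delay /stamp_set /=.
  by move=> /intr_inj /subrI; exact.
by move=> ->.
Qed.

Lemma stamp_set_measurable i t s : measurable (stamp_set i t s).
Proof. exact: sdelay_measurable (stamp_set_sdelay i t s). Qed.

Lemma stamp_set_past i r t s : (r < t)%N ->
  @measurable _ (pastType t) (stamp_set i r s).
Proof.
move=> rt; apply: sub_sigma_algebra.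
exact: (@past_system_delay _ (r, i) _ rt (stamp_set_sdelay i r s)).
Qed.

Lemma stamp_lower i t w : kappa * t%:R <= (tau i t w)%:~R :> R.
Proof. by have := delay_bound delays i t w; rewrite /delay intrB /=; lra. Qed.

(** The bound kappa t <= tau already forces a nonnegative stamp, so the branch without any received
    information never occurs. *)
Lemma stamp_exists i t w : exists2 s, (s <= t)%N & tau i t w = s%:Z.
Proof.
have h := stamp_lower i t w; have /andP[_ ht] := stamp_bounds process i t w.
have /andP[k0 _] := delay_kappa delays.
have : 0 <= tau i t w.
  rewrite -(ler_int R); apply: le_trans h; by rewrite mulr_ge0// ltW.
case: (tau i t w) ht => // s; rewrite lez_nat => st _.
by exists s.
Qed.

Lemma stamp_set_ge i t s w : stamp_set i t s w -> kappa * t%:R <= s%:R.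
Proof. by move=> h; have := stamp_lower i t w; rewrite h. Qed.

(** Turns evaluation at a random index into a finite sum over deterministic ones; used for vectors,
    and for scalars through [R^o]. *)
Lemma sum_stamp (V : lmodType R) i t (F : nat -> V) w s0 : (s0 <= t)%N ->
  tau i t w = s0%:Z ->
  \sum_(s < t.+1) \1_(stamp_set i t s) w *: F s = F s0.
Proof.
move=> st e; have st' : (s0 < t.+1)%N by [].
rewrite (bigD1 (Ordinal st'))//= indicE mem_set// scale1r big1 ?addr0// => s hs.
rewrite indicE memNset ?scale0r//= /stamp_set /= e => -[] /esym h.
by move/eqP: hs; apply; exact: val_inj.
Qed.

Notation est := (estimate g xi x).

Lemma stale_estimateE i t w : stale_estimate g xi tau x i t w =
  \sum_(s < t.+1) \1_(stamp_set i t s) w *: est i s w.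
Proof.
have [s st e] := stamp_exists i t w.
by rewrite (sum_stamp _ _ _ (fun s => est i s w) _ _ st e) /stale_estimate e.
Qed.

Lemma iterate_in t w : S (x t w).
Proof.
case: t => [|t]; first by rewrite (iterate_init process).
by rewrite (iterate_step process); apply: (euclid_projP _ _ S_closed _).1; exists x0.
Qed.

Lemma estimate_past_measurable t i s :
  measurable_fun setT (x s : pastType t -> borel_rV R d) ->
  measurable_fun setT (est i s : pastType t -> borel_rV R d).
Proof.
move=> mx.
have := measurableT_comp (estimator_measurable process i)
  (measurable_fun_pair mx (noise_past_measurable t s)).
exact.
Qed.

(** Strong induction, because x(s+1) depends on every earlier iterate through the stale estimates.
    It involves delays of rounds up to s < t only, which is what keeps even x(t) in the past of
    round [t]. *)
Lemma iterate_past_measurable t s : (s <= t)%N ->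
  measurable_fun setT (x s : pastType t -> borel_rV R d).
Proof.
elim/ltn_ind: s => -[|s] IH st.
  rewrite (_ : x 0%N = cst x0); first exact: measurable_cst.
  by apply/funext => w; rewrite (iterate_init process).
rewrite (_ : x s.+1 = fun w => euclid_proj S (x s w - eta s *:
    \sum_i \sum_(r < s.+1) \1_(stamp_set i s r) w *: est i r w)); last first.
  apply/funext => w; rewrite (iterate_step process).
  by congr (euclid_proj S (_ - _ *: _)); apply: eq_bigr => i _; rewrite stale_estimateE.
apply: measurable_euclid_proj => //; first by exists x0.
apply: borel_rV_measurable => j.
have -> : (fun w : pastType t => (x s w - eta s *:
    \sum_i \sum_(r < s.+1) \1_(stamp_set i s r) w *: est i r w) 0 j) =
  (fun w : pastType t => x s w 0 j - eta s *
    \sum_i \sum_(r < s.+1) \1_(stamp_set i s r) w * est i r w 0 j).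
  apply/funext => w; rewrite !mxE summxE; congr (_ - _ * _).
  apply: eq_bigr => i _; rewrite summxE; apply: eq_bigr => r _; by rewrite mxE.
apply: measurable_funB.
  by apply: measurable_borel_rV; apply: IH => //; exact: ltnW.
apply: measurable_funM => //; apply: measurable_sum => i; apply: measurable_sum => r.
apply: measurable_funM; first by apply: measurable_indic; exact: stamp_set_past.
apply: measurable_borel_rV; apply: estimate_past_measurable.
by apply: IH; [exact: ltn_ord|apply: leq_trans st; exact: ltnW].
Qed.

Lemma iterate_borel_measurable t : measurable_fun setT (x t : T -> borel_rV R d).
Proof.
apply: (@g_sigma_measurable_fun _ _ _ _ (past_system t)).
  exact: past_system_measurable.
exact: iterate_past_measurable.
Qed.

Lemma iterate_measurable t j : measurable_fun setT (fun w => x t w 0 j).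
Proof. by apply: measurable_borel_rV; exact: iterate_borel_measurable. Qed.

Lemma estimate_measurable i t j : measurable_fun setT (fun w => est i t w 0 j).
Proof.
apply: measurable_borel_rV; apply: (@g_sigma_measurable_fun _ _ _ _ (past_system t)).
  exact: past_system_measurable.
by apply: estimate_past_measurable; exact: iterate_past_measurable.
Qed.

Lemma iterate_past_coord t s j : (s <= t)%N ->
  measurable_fun setT ((fun w => x s w 0 j) : pastType t -> R).
Proof. by move=> st; apply: measurable_borel_rV; exact: iterate_past_measurable. Qed.

Lemma estimate_past_coord t i s j : (s <= t)%N ->
  measurable_fun setT ((fun w => est i s w 0 j) : pastType t -> R).
Proof.
move=> st; apply: measurable_borel_rV; apply: estimate_past_measurable.
exact: iterate_past_measurable.
Qed.

Lemma sigma_iterate_measurable t : sigma_iterate x t `<=` measurable.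
Proof. by move=> _ [B mB <-]; exact: iterate_borel_measurable. Qed.

Lemma sigma_iterateT t : sigma_iterate x t setT.
Proof. by exists setT => //; rewrite setTI preimage_setT. Qed.

Lemma sigma_iterate_coord t (xs : 'rV[R]_d) j (B : set R) : measurable B ->
  sigma_iterate x t ((fun w => (x t w - xs) 0 j) @^-1` B).
Proof.
move=> mB; exists ((fun y : borel_rV R d => y 0 j - xs 0 j) @^-1` B).
  rewrite -[X in measurable X]setTI.
  have mj : measurable_fun setT (fun y : borel_rV R d => y 0 j - xs 0 j).
    apply: measurable_funB => //.
    exact: (@measurable_borel_rV R d _ (borel_rV R d) id j).
  exact: mj.
by rewrite setTI; apply/seteqP; split=> w /=; rewrite !mxE.
Qed.

Definition stamp_prob (i : 'I_n) (t s : nat) : R := fine (P (stamp_set i t s)).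

Lemma Rint_stamp i t s (Y : T -> R) : measurable_fun setT (Y : pastType t -> R) ->
  summable_rv P Y ->
  \int[P]_w (\1_(stamp_set i t s) w * Y w) = stamp_prob i t s * \int[P]_w Y w.
Proof.
move=> mY hY; apply: (@Rint_independent_generated _ _ _ _ _ (past_system t)) => //.
- exact: stamp_set_measurable.
- exact: past_systemI.
- exact: past_system_measurable.
- by move=> B; apply: (@past_system_independent t i); exact: stamp_set_sdelay.
Qed.

Lemma stamp_prob_ge0 i t s : 0 <= stamp_prob i t s.
Proof. exact: fine_ge0. Qed.

Lemma stamp_prob_eq0 i t s : s%:R < kappa * t%:R -> stamp_prob i t s = 0.
Proof.
move=> h; rewrite /stamp_prob (_ : stamp_set i t s = set0) ?measure0//.
by apply/seteqP; split=> w // /stamp_set_ge; rewrite leNgt h.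
Qed.

Lemma Rint_stamp_sum i t (F : nat -> T -> R) :
  (forall s, (s <= t)%N -> measurable_fun setT (F s : pastType t -> R)) ->
  (forall s, (s <= t)%N -> summable_rv P (F s)) ->
  \int[P]_w (\sum_(s < t.+1) \1_(stamp_set i t s) w * F s w) =
  \sum_(s < t.+1) stamp_prob i t s * \int[P]_w F s w.
Proof.
move=> mF hF; rewrite Rint_sum => [|s]; last first.
  by apply: summable_indic; [exact: stamp_set_measurable|apply: hF; rewrite -ltnS].
apply: eq_bigr => s _; apply: Rint_stamp; [apply: mF|apply: hF]; by rewrite -ltnS.
Qed.

(** Expectation of a function of the stamp alone; it yields both the total mass and the second
    moment of the lag. *)
Lemma sum_stamp_prob_cst i t (c : nat -> R) (u : T -> R) :
  (forall w, \sum_(s < t.+1) \1_(stamp_set i t s) w * c s = u w) ->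
  \int[P]_w u w = \sum_(s < t.+1) stamp_prob i t s * c s.
Proof.
move=> h; have := Rint_stamp_sum i t (fun s _ => c s).
under eq_Rintegral do rewrite h.
move=> -> => [|s _|s _]; [|exact: measurable_cst|exact: summable_cst].
by apply: eq_bigr => s _; rewrite (Rint_cst P).
Qed.

Lemma sum_stamp_prob i t : \sum_(s < t.+1) stamp_prob i t s = 1.
Proof.
have := sum_stamp_prob_cst i t (fun=> 1) (fun=> 1).
rewrite (Rint_cst P) => -> => [|w].
  by apply: eq_bigr => s _; rewrite mulr1.
have [s st e] := stamp_exists i t w.
exact: (sum_stamp R^o i t (fun=> 1) w s st e).
Qed.

Lemma sum_stamp_prob_sqr i t :
  \sum_(s < t.+1) stamp_prob i t s * (t - s)%:R ^+ 2 <= C.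
Proof.
have h w : \sum_(s < t.+1) \1_(stamp_set i t s) w * (t - s)%:R ^+ 2 =
    delayed i t w ^+ 2.
  have [s st e] := stamp_exists i t w.
  rewrite (sum_stamp R^o i t (fun s => (t - s)%:R ^+ 2) w s st e) /delay e.
  by rewrite subzn.
rewrite -(sum_stamp_prob_cst i t (fun s => (t - s)%:R ^+ 2) _ h).
rewrite -lee_fin -EFin_Rint; first exact: (delay_second_moment delays).
under [X in summable_rv _ X]eq_fun do rewrite -h.
apply: summable_sum => s; apply: summable_indic; last exact: summable_cst.
exact: stamp_set_measurable.
Qed.

(** An integer lag is at most its square, so the second moment also controls the first. The added 1
    serves the Young weight of [Rint_dot_move_ge]. *)
Lemma sum_stamp_prob_lag i t :
  \sum_(s < t.+1) stamp_prob i t s * ((t - s)%:R + 1) <= C + 1.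
Proof.
apply: (@le_trans _ _ (\sum_(s < t.+1)
    (stamp_prob i t s * (t - s)%:R ^+ 2 + stamp_prob i t s))).
  apply: ler_sum => s _; rewrite mulrDr mulr1 lerD2r ler_wpM2l ?stamp_prob_ge0//.
  by rewrite -natrX ler_nat; case: (t - s)%N => // k; rewrite leq_pmulr.
by rewrite big_split/= sum_stamp_prob lerD2r sum_stamp_prob_sqr.
Qed.

(** * Moments, drift and the recursion for the squared error *)

Context (f : 'I_n -> 'rV[R]_d -> R) (df : 'I_n -> 'rV[R]_d -> 'rV[R]_d).
Context (gtilde : 'I_n -> nat -> T -> 'rV[R]_d) (q : nat -> R) (xs : 'rV[R]_d).
Context (L G mu : R) (n_gt0 : (0 < n)%N) (eta_gt0 : forall t, 0 < eta t).
Context (objective : objective_assumption S f df L).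
Context (estimators : estimator_assumption P g xi x df L G gtilde q).
Context (mu_gt0 : 0 < mu).
Context (f_strongly_convex : strongly_convex_on S mu (total_obj f) (total_grad df)).
Context (xs_argmin : is_argmin S (total_obj f) xs).

Lemma G_ge0 : 0 <= G.
Proof. exact: ltW (est_G_gt0 estimators). Qed.

Lemma vsqint_estimate i t : vsqint P (est i t).
Proof.
have [V [hV _]] := est_second_moment estimators i t.
apply: (le_vsqint _ _ _ _ (cond_exp_integrableY hV)).
  by move=> j; exact: estimate_measurable.
by apply: nearW => w; rewrite sqr_enorm.
Qed.

Lemma Rint_estimate_le i t : \int[P]_w dot (est i t w) (est i t w) <= G.
Proof.
have [V [hV VG]] := est_second_moment estimators i t.
have -> : \int[P]_w dot (est i t w) (est i t w) = \int[P]_w V w.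
  under eq_Rintegral do rewrite -sqr_enorm.
  by rewrite /Rintegral (cond_expE hV)//; exact: sigma_iterateT.
rewrite -[leRHS](Rint_cst P); apply: le_Rint => //.
  exact: (cond_exp_integrableV hV).
exact: summable_cst.
Qed.

Lemma vsqint_stale i t : vsqint P (stale_estimate g xi tau x i t).
Proof.
rewrite (_ : stale_estimate g xi tau x i t =
    fun w => \sum_(s < t.+1) \1_(stamp_set i t s) w *: est i s w); last first.
  by apply/funext => w; exact: stale_estimateE.
apply: vsqint_sum => s; apply: vsqint_indic; first exact: stamp_set_measurable.
exact: vsqint_estimate.
Qed.

Notation server t w := (\sum_i stale_estimate g xi tau x i t w).

Lemma vsqint_server t : vsqint P (fun w => server t w).
Proof. by apply: vsqint_sum => i; exact: vsqint_stale. Qed.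

Lemma dot_step_le t w : dot (x t.+1 w - xs) (x t.+1 w - xs) <=
  dot (x t w - xs - eta t *: server t w) (x t w - xs - eta t *: server t w).
Proof.
have Sxs := xs_argmin.1.
rewrite (iterate_step process) -{1 2}(euclid_proj_id _ _ S_closed S_convex Sxs).
rewrite addrAC; apply: euclid_proj_contract => //; by exists x0.
Qed.

Lemma vsqint_error t : vsqint P (fun w => x t w - xs).
Proof.
elim: t => [|t IH].
  under [X in vsqint _ X]eq_fun do rewrite (iterate_init process).
  exact: vsqint_cst.
have hz : vsqint P (fun w => x t w - xs - eta t *: server t w).
  by apply: vsqintB => //; apply: vsqintZ; exact: vsqint_server.
apply: (le_vsqint _ _ _ _ (summable_dot _ _ _ hz hz)).
  move=> j; under eq_fun do rewrite !mxE.
  by apply: measurable_funB => //; exact: iterate_measurable.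
by apply: nearW => w; exact: dot_step_le.
Qed.

Lemma vsqint_move s t : vsqint P (fun w => x t w - x s w).
Proof.
rewrite (_ : (fun w => _) = fun w => (x t w - xs) - (x s w - xs)).
  by apply: vsqintB; exact: vsqint_error.
by apply/funext => w; rewrite opprB addrA subrK.
Qed.

Lemma dot_stale_sum i t w (u : T -> 'rV[R]_d) :
  dot (stale_estimate g xi tau x i t w) (u w) =
  \sum_(s < t.+1) \1_(stamp_set i t s) w * dot (est i s w) (u w).
Proof.
rewrite stale_estimateE dot_suml; apply: eq_bigr => s _; by rewrite dotZl.
Qed.

(** There are no cross terms, as exactly one stamp event contains [w]. *)
Lemma sqr_stale_sum i t w :
  dot (stale_estimate g xi tau x i t w) (stale_estimate g xi tau x i t w) =
  \sum_(s < t.+1) \1_(stamp_set i t s) w * dot (est i s w) (est i s w).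
Proof.
have [s st e] := stamp_exists i t w.
rewrite (sum_stamp R^o i t (fun s => dot (est i s w) (est i s w)) w s st e).
by rewrite /stale_estimate e.
Qed.

Lemma past_measurable_dot t (U V : T -> 'rV[R]_d) :
  (forall j, measurable_fun setT ((fun w => U w 0 j) : pastType t -> R)) ->
  (forall j, measurable_fun setT ((fun w => V w 0 j) : pastType t -> R)) ->
  measurable_fun setT ((fun w => dot (U w) (V w)) : pastType t -> R).
Proof.
by move=> mU mV; apply: measurable_sum => j; exact: measurable_funM.
Qed.

Lemma Rint_stale_le i t :
  \int[P]_w dot (stale_estimate g xi tau x i t w) (stale_estimate g xi tau x i t w) <= G.
Proof.
under eq_Rintegral do rewrite sqr_stale_sum.
rewrite (Rint_stamp_sum i t (fun s w => dot (est i s w) (est i s w))); last 2 first.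
- by move=> s st; apply: past_measurable_dot => j; exact: estimate_past_coord.
- by move=> s st; apply: summable_dot; exact: vsqint_estimate.
rewrite -[leRHS]mul1r -(sum_stamp_prob i t) mulr_suml; apply: ler_sum => s _.
by rewrite ler_wpM2l ?stamp_prob_ge0// Rint_estimate_le.
Qed.

Lemma Rint_server_le t : \int[P]_w dot (server t w) (server t w) <= n%:R ^+ 2 * G.
Proof.
apply: (@le_trans _ _ (\int[P]_w (n%:R * \sum_i
    dot (stale_estimate g xi tau x i t w) (stale_estimate g xi tau x i t w)))).
  have hs : summable_rv P (fun w => \sum_i
      dot (stale_estimate g xi tau x i t w) (stale_estimate g xi tau x i t w)).
    by apply: summable_sum => i; apply: summable_dot; exact: vsqint_stale.
  apply: le_Rint; first by apply: summable_dot; exact: vsqint_server.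
    exact: summableZ.
  apply: nearW => w; apply: (le_trans (dot_sum_le _ _ _)).
  rewrite [size _](_ : _ = n)// /index_enum.
  by case: index_enum_key; rewrite -enumT size_enum_ord.
rewrite RintZ; last first.
  by apply: summable_sum => i; apply: summable_dot; exact: vsqint_stale.
rewrite Rint_sum; last by move=> i; apply: summable_dot; exact: vsqint_stale.
rewrite expr2 -mulrA ler_wpM2l//; apply: (@le_trans _ _ (\sum_(i < n) G)).
  by apply: ler_sum => i _; exact: Rint_stale_le.
by rewrite sumr_const card_ord mulr_natl.
Qed.

(** Telescope and use that x(r), lying in [S], is its own projection, so one step moves at most
    eta(r) times the norm of the server gradient. *)
Lemma dot_move_le s t w : (s <= t)%N ->
  dot (x t w - x s w) (x t w - x s w) <=
  (t - s)%:R * \sum_(s <= r < t) eta r ^+ 2 * dot (server r w) (server r w).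
Proof.
move=> st; rewrite -(telescope_sumr (fun r => x r w) st).
apply: (le_trans (dot_sum_le _ _ _)); rewrite size_iota ler_wpM2l//.
apply: ler_sum => r _.
have Sx := iterate_in r w.
rewrite -{1 2}(euclid_proj_id _ _ S_closed S_convex Sx) (iterate_step process).
apply: le_trans.
  by apply: euclid_proj_contract => //; exists x0.
by rewrite addrAC subrr add0r -scaleNr dotZl dotZr mulrA mulrNN -expr2.
Qed.

Lemma Rint_move_le s t h : (s <= t)%N -> (forall r, (s <= r)%N -> eta r <= h) ->
  \int[P]_w dot (x t w - x s w) (x t w - x s w) <=
  (t - s)%:R ^+ 2 * h ^+ 2 * (n%:R ^+ 2 * G).
Proof.
move=> st hr.
have hs r : summable_rv P (fun w => eta r ^+ 2 * dot (server r w) (server r w)).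
  by apply: summableZ; apply: summable_dot; exact: vsqint_server.
have hS : summable_rv P (fun w =>
    \sum_(s <= r < t) eta r ^+ 2 * dot (server r w) (server r w)).
  exact: summable_sum.
apply: (@le_trans _ _ (\int[P]_w ((t - s)%:R *
    \sum_(s <= r < t) eta r ^+ 2 * dot (server r w) (server r w)))).
  apply: le_Rint; first by apply: summable_dot; exact: vsqint_move.
    exact: summableZ.
  by apply: nearW => w; exact: dot_move_le.
rewrite RintZ// Rint_sum//.
rewrite [leRHS](_ : _ = (t - s)%:R * ((t - s)%:R * (h ^+ 2 * (n%:R ^+ 2 * G))));
  last by ring.
rewrite ler_wpM2l//.
apply: (@le_trans _ _ (\sum_(s <= r < t) (h ^+ 2 * (n%:R ^+ 2 * G)))).
  rewrite big_nat [leRHS]big_nat; apply: ler_sum => r /andP[sr _].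
  rewrite RintZ; last by apply: summable_dot; exact: vsqint_server.
  have h0 : 0 <= eta r by exact: ltW.
  apply: ler_pM; rewrite ?sqr_ge0 ?Rint_sqr_ge0 ?Rint_server_le//.
  by rewrite lerXn2r ?nnegrE ?(le_trans h0)// hr.
by rewrite sumr_const_nat -[leLHS]mulr_natl.
Qed.

Lemma enorm_le_sqr (a b : 'rV[R]_d) l : enorm a <= l * enorm b ->
  dot a a <= l ^+ 2 * dot b b.
Proof.
move=> h; rewrite -!sqr_enorm -exprMn.
by rewrite lerXn2r ?nnegrE ?(le_trans _ h)// enorm_ge0.
Qed.

(** A crude bound through the bias and the Lipschitz gradient at [xs], for integrability only: the
    bound by [G] compares second moments and presupposes it. *)
Lemma vsqint_gtilde i t : vsqint P (gtilde i t).
Proof.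
pose c := dot (df i xs) (df i xs).
have hD : summable_rv P (fun w => 2 * q t ^+ 2 +
    2 * (2 * (L ^+ 2 * dot (x t w - xs) (x t w - xs)) + 2 * c)).
  apply: summableD; first exact: summable_cst.
  apply: summableZ; apply: summableD; last exact: summable_cst.
  by do 2 apply: summableZ; apply: summable_dot; exact: vsqint_error.
apply: (le_vsqint _ _ _ _ hD).
  by move=> j; apply: summable_meas (cond_exp_integrableV (est_cond_mean estimators i t j)).
apply: filterS (est_bias estimators i t) => w hb.
have h1 : dot (gtilde i t w - df i (x t w)) (gtilde i t w - df i (x t w)) <= q t ^+ 2.
  rewrite -sqr_enorm lerXn2r ?nnegrE ?enorm_ge0//.
  exact: (est_q_ge0 estimators).
have h2 := enorm_le_sqr _ _ _ (obj_smooth_i objective i (iterate_in t w) xs_argmin.1).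
have h3 := dotD_le (gtilde i t w - df i (x t w)) (df i (x t w)).
have h4 := dotD_le (df i (x t w) - df i xs) (df i xs).
rewrite !subrK in h3 h4; rewrite /c; lra.
Qed.

Lemma Rint_gtilde_le i t : \int[P]_w dot (gtilde i t w) (gtilde i t w) <= G.
Proof.
apply: le_trans (Rint_estimate_le i t).
apply: (@Rint_cond_exp_sqr_le _ _ _ _ _ (sigma_iterate x t)).
- exact: sigma_iterate_measurable.
- exact: (est_cond_mean estimators).
- exact: vsqint_estimate.
- exact: vsqint_gtilde.
Qed.

(** Estimate and error carry the same time here; this makes the error measurable for sigma(x(t)),
    the only conditioning available. *)
Lemma Rint_estimate_error i t :
  \int[P]_w dot (est i t w) (x t w - xs) = \int[P]_w dot (gtilde i t w) (x t w - xs).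
Proof.
apply: (@Rint_cond_exp_dot _ _ _ _ _ (sigma_iterate x t)).
- exact: sigma_iterate_measurable.
- exact: (est_cond_mean estimators).
- by move=> j B; exact: sigma_iterate_coord.
- exact: vsqint_estimate.
- exact: vsqint_gtilde.
- exact: vsqint_error.
Qed.

(** The Young weight (m + 1) h n makes both halves at most c G, so the cost is linear in [h]; the
    added 1 keeps the weight positive when s = t. The free times s', t' allow either orientation of
    the displacement. *)
Lemma Rint_dot_move_ge s t h (U : T -> 'rV[R]_d) (s' t' : nat) : 0 < h ->
  vsqint P U -> \int[P]_w dot (U w) (U w) <= G ->
  \int[P]_w dot (x t' w - x s' w) (x t' w - x s' w) <=
    (t - s)%:R ^+ 2 * h ^+ 2 * (n%:R ^+ 2 * G) ->
  \int[P]_w dot (U w) (x t' w - x s' w) <= ((t - s)%:R + 1) * h * n%:R * G.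
Proof.
move=> h0 hU UG hM; have nR : 0 < n%:R :> R by rewrite ltr0n.
set m : R := (t - s)%:R in hM *; have m0 : 0 <= m by [].
pose c := (m + 1) * h * n%:R.
have c0 : 0 < c by rewrite !mulr_gt0// ltr_wpDl.
have := Rint_young _ _ _ _ c0 hU (vsqint_move s' t').
set I2 := \int[P]_w dot (x t' w - x s' w) _ in hM *.
have h1 : c * \int[P]_w dot (U w) (U w) <= c * G by rewrite ler_wpM2l ?(ltW c0).
have h2 : c^-1 * I2 <= c * G.
  rewrite ler_pdivrMl//; apply: (le_trans hM).
  rewrite [leLHS]mulrA [leRHS]mulrA ler_wpM2r ?G_ge0//.
  rewrite /c -!exprMn -expr2 lerXn2r ?nnegrE ?mulr_ge0 ?(ltW h0) ?(ltW nR)//.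
    by rewrite addr_ge0.
  by rewrite ler_wpM2r ?(ltW nR)// ler_wpM2r ?(ltW h0)// lerDl.
rewrite -/c; lra.
Qed.

(* For a stamp [s] the stale estimate is moved to time [t] in three steps:
   <est_s, D_t> = <est_s, D_s> + <est_s, x_t - x_s>, conditioning on x_s turns
   the first term into <gt_s, D_s>, and gt_s, D_s are compared with gt_t, D_t. *)
Lemma Rint_estimate_error_ge i s t h eps : (s <= t)%N -> 0 < h -> 0 < eps ->
  (forall r, (s <= r)%N -> eta r <= h) ->
  \int[P]_w dot (gtilde i t w) (x t w - xs)
  - 2 * (((t - s)%:R + 1) * h * n%:R * G)
  - (eps * \int[P]_w dot (x t w - xs) (x t w - xs)
     + eps^-1 * (L ^+ 2 * ((t - s)%:R ^+ 2 * h ^+ 2 * (n%:R ^+ 2 * G)))) / 2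
  <= \int[P]_w dot (est i s w) (x t w - xs).
Proof.
move=> st h0 eps0 hr.
have hM := Rint_move_le _ _ _ st hr.
have hM' : \int[P]_w dot (x s w - x t w) (x s w - x t w) <=
    (t - s)%:R ^+ 2 * h ^+ 2 * (n%:R ^+ 2 * G).
  by under eq_Rintegral do rewrite -opprB dotNl dotNr opprK.
have hEs := vsqint_estimate i s; have hGs := vsqint_gtilde i s.
have hGt := vsqint_gtilde i t; have hDt := vsqint_error t; have hDs := vsqint_error s.
have e1 : \int[P]_w dot (est i s w) (x t w - xs) =
    \int[P]_w dot (est i s w) (x s w - xs) - \int[P]_w dot (est i s w) (x s w - x t w).
  rewrite -RintB; try by apply: summable_dot => //; exact: vsqint_move.
  apply: eq_Rintegral => w _; rewrite -dotBr; congr (dot _ _).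
  by apply/rowP => k; rewrite !mxE; ring.
have e2 : \int[P]_w dot (gtilde i s w) (x s w - xs) =
    \int[P]_w dot (gtilde i s w) (x t w - xs) - \int[P]_w dot (gtilde i s w) (x t w - x s w).
  rewrite -RintB; try by apply: summable_dot => //; exact: vsqint_move.
  apply: eq_Rintegral => w _; rewrite -dotBr; congr (dot _ _).
  by apply/rowP => k; rewrite !mxE; ring.
have e3 : \int[P]_w dot (gtilde i s w) (x t w - xs) =
    \int[P]_w dot (gtilde i t w) (x t w - xs)
    - \int[P]_w dot (x t w - xs) (gtilde i t w - gtilde i s w).
  rewrite -RintB; try by apply: summable_dot => //; exact: vsqintB.
  apply: eq_Rintegral => w _; rewrite (dotC (gtilde i t w)) -dotBr dotC; congr (dot _ _).
  by apply/rowP => k; rewrite !mxE; ring.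
have b1 := Rint_dot_move_ge s t h _ t s h0 hEs (Rint_estimate_le i s) hM'.
have b2 := Rint_dot_move_ge s t h _ s t h0 hGs (Rint_gtilde_le i s) hM.
(* The small weight goes to the current error, where strong convexity absorbs it; its inverse
   multiplies a term of order h^2. *)
have b3 := Rint_young _ _ _ _ eps0 hDt (vsqintB _ _ _ hGt hGs).
have b4 : \int[P]_w dot (gtilde i t w - gtilde i s w) (gtilde i t w - gtilde i s w) <=
    L ^+ 2 * ((t - s)%:R ^+ 2 * h ^+ 2 * (n%:R ^+ 2 * G)).
  apply: (@le_trans _ _ (\int[P]_w (L ^+ 2 * dot (x t w - x s w) (x t w - x s w)))).
    apply: le_Rint.
    - by apply: summable_dot; exact: vsqintB.
    - by apply: summableZ; apply: summable_dot; exact: vsqint_move.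
    - apply: filterS (est_lipschitz estimators i t s) => w; exact: enorm_le_sqr.
  rewrite RintZ; last by apply: summable_dot; exact: vsqint_move.
  by rewrite ler_wpM2l ?sqr_ge0.
have b5 : eps^-1 * \int[P]_w dot (gtilde i t w - gtilde i s w)
                                 (gtilde i t w - gtilde i s w) <=
    eps^-1 * (L ^+ 2 * ((t - s)%:R ^+ 2 * h ^+ 2 * (n%:R ^+ 2 * G))).
  by rewrite ler_wpM2l ?invr_ge0 ?(ltW eps0).
rewrite e1 Rint_estimate_error e2 e3.
move: b1 b2 (le_trans b3 (lerD (lexx _) b5)).
move: (eps^-1 * (L ^+ 2 * _)) (((t - s)%:R + 1) * h * n%:R * G) => v u.
move: (eps * _) (\int[P]_w dot (est i s w) (x s w - x t w)) => z I1.
move: (\int[P]_w dot (gtilde i s w) (x t w - x s w)) => I2.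
move: (\int[P]_w dot (x t w - xs) (gtilde i t w - gtilde i s w)) => I3.
move: (\int[P]_w dot (gtilde i t w) (x t w - xs)) => I4 h1 h2 h3.
clear hM hM' b3 b4 b5 e1 e2 e3; lra.
Qed.

(** In the bound for a fixed stamp the lag appears only through lag + 1 and lag^2, whose means are
    at most C + 1 and C. *)
Lemma Rint_stale_error_ge i t h eps : 0 < h -> 0 < eps ->
  (forall r : nat, kappa * t%:R <= r%:R -> eta r <= h) ->
  \int[P]_w dot (gtilde i t w) (x t w - xs)
  - 2 * ((C + 1) * h * n%:R * G)
  - (eps * \int[P]_w dot (x t w - xs) (x t w - xs)
     + eps^-1 * (L ^+ 2 * (C * h ^+ 2 * (n%:R ^+ 2 * G)))) / 2
  <= \int[P]_w dot (stale_estimate g xi tau x i t w) (x t w - xs).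
Proof.
move=> h0 eps0 hr.
set A := \int[P]_w dot (gtilde i t w) _.
set B := \int[P]_w dot (x t w - xs) _.
have -> : \int[P]_w dot (stale_estimate g xi tau x i t w) (x t w - xs) =
    \sum_(s < t.+1) stamp_prob i t s * \int[P]_w dot (est i s w) (x t w - xs).
  under eq_Rintegral do rewrite (dot_stale_sum i t _ (fun w => x t w - xs)).
  apply: (Rint_stamp_sum i t (fun s w => dot (est i s w) (x t w - xs))) => s st.
    apply: past_measurable_dot => j; first exact: estimate_past_coord.
    under eq_fun do rewrite !mxE.
    by apply: measurable_funB => //; exact: iterate_past_coord.
  by apply: summable_dot; [exact: vsqint_estimate|exact: vsqint_error].
pose k1 := 2 * (h * n%:R * G).
pose k2 := eps^-1 * (L ^+ 2 * (h ^+ 2 * (n%:R ^+ 2 * G))) / 2.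
have k10 : 0 <= k1 by rewrite !mulr_ge0 ?G_ge0 ?(ltW h0).
have k20 : 0 <= k2.
  have e0 : 0 <= eps^-1 by rewrite invr_ge0 ltW.
  rewrite /k2 mulr_ge0 ?invr_ge0// mulr_ge0// mulr_ge0 ?sqr_ge0//.
  by rewrite mulr_ge0 ?sqr_ge0// mulr_ge0 ?sqr_ge0 ?G_ge0.
apply: (@le_trans _ _ (\sum_(s < t.+1) stamp_prob i t s *
    ((A - eps * B / 2) - k1 * ((t - s)%:R + 1) - k2 * (t - s)%:R ^+ 2))).
  have -> : \sum_(s < t.+1) stamp_prob i t s *
      ((A - eps * B / 2) - k1 * ((t - s)%:R + 1) - k2 * (t - s)%:R ^+ 2) =
    (A - eps * B / 2) * \sum_(s < t.+1) stamp_prob i t s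
    - k1 * \sum_(s < t.+1) stamp_prob i t s * ((t - s)%:R + 1)
    - k2 * \sum_(s < t.+1) stamp_prob i t s * (t - s)%:R ^+ 2.
    rewrite !mulr_sumr -!sumrB; apply: eq_bigr => s _; ring.
  have h1 := ler_wpM2l k10 (sum_stamp_prob_lag i t).
  have h2 := ler_wpM2l k20 (sum_stamp_prob_sqr i t).
  rewrite sum_stamp_prob mulr1; rewrite /k1 /k2 in h1 h2 *; lra.
(* Below kappa t the step sizes are not bounded by [h], but such stamps have probability zero. *)
apply: ler_sum => s _; have [hs|hs] := ltP s%:R (kappa * t%:R).
  by rewrite stamp_prob_eq0// !mul0r.
rewrite ler_wpM2l ?stamp_prob_ge0//.
have st : (s <= t)%N by rewrite -ltnS.
have := Rint_estimate_error_ge i s t h eps st h0 eps0.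
rewrite -/A -/B => hh; apply: le_trans (hh _); last first.
  by move=> r sr; apply: hr; apply: (le_trans hs); rewrite ler_nat.
rewrite /k1 /k2; lra.
Qed.

(** Bias is controlled agent by agent and strong convexity only for the sum: Young is applied to
    each agent, and the gradients are summed before convexity is used. *)
Lemma Rint_gtilde_error_ge t eps : 0 < eps ->
  mu * \int[P]_w dot (x t w - xs) (x t w - xs)
  - n%:R * ((eps * \int[P]_w dot (x t w - xs) (x t w - xs) + eps^-1 * q t ^+ 2) / 2)
  <= \sum_i \int[P]_w dot (gtilde i t w) (x t w - xs).
Proof.
move=> eps0.
have hD := vsqint_error t.
have sD : summable_rv P (fun w => dot (x t w - xs) (x t w - xs)) by exact: summable_dot.
rewrite -Rint_sum; last by move=> i; apply: summable_dot => //; exact: vsqint_gtilde.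
pose k := mu - n%:R * eps / 2; pose c := n%:R * (eps^-1 * q t ^+ 2) / 2.
apply: (@le_trans _ _ (\int[P]_w (k * dot (x t w - xs) (x t w - xs) - c))).
  rewrite RintB; [|exact: summableZ|exact: summable_cst].
  rewrite RintZ// (Rint_cst P) /k /c; lra.
apply: le_Rint.
- by apply: summableB; [exact: summableZ|exact: summable_cst].
- by apply: summable_sum => i; apply: summable_dot => //; exact: vsqint_gtilde.
have hb : {ae P, forall w, forall i, enorm (gtilde i t w - df i (x t w)) <= q t}.
  by apply: filter_forall => i; exact: (est_bias estimators i t).
apply: filterS hb => w hb.
have h0 := strongly_convex_dot _ _ _ _ _ _ S_convex mu_gt0 f_strongly_convex xs_argmin
  (iterate_in t w).
have hi i : dot (df i (x t w)) (x t w - xs)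
    - (eps * dot (x t w - xs) (x t w - xs) + eps^-1 * q t ^+ 2) / 2
    <= dot (gtilde i t w) (x t w - xs).
  have y := dot_young _ (x t w - xs) (df i (x t w) - gtilde i t w) eps0.
  rewrite dotBr (dotC _ (df _ _)) (dotC _ (gtilde _ _ _)) in y.
  have : dot (df i (x t w) - gtilde i t w) (df i (x t w) - gtilde i t w) <= q t ^+ 2.
    rewrite -opprB dotNl dotNr opprK -sqr_enorm lerXn2r ?nnegrE ?enorm_ge0 ?hb//.
    exact: (est_q_ge0 estimators).
  have e0 : 0 <= eps^-1 by rewrite invr_ge0 ltW.
  move=> /(ler_wpM2l e0); lra.
apply: (@le_trans _ _ (\sum_i (dot (df i (x t w)) (x t w - xs)
    - (eps * dot (x t w - xs) (x t w - xs) + eps^-1 * q t ^+ 2) / 2))); last first.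
  by apply: ler_sum => i _; exact: hi.
rewrite sumrB -dot_suml sumr_const card_ord -mulr_natl.
rewrite /total_grad in h0; rewrite /k /c; lra.
Qed.

Definition sq_error t : R := \int[P]_w dot (x t w - xs) (x t w - xs).

Lemma sq_error_ge0 t : 0 <= sq_error t.
Proof. exact: Rint_sqr_ge0. Qed.

Lemma mean_sq_errorE t : mean_sq_error P x xs t = (sq_error t)%:E.
Proof.
rewrite /mean_sq_error -EFin_Rint.
  by congr ('E_P[_])%E; apply/funext => w; rewrite sqr_enorm.
by apply: summable_dot; exact: vsqint_error.
Qed.

Lemma sq_error_recursion delta : 0 < delta -> exists2 K, 0 <= K &
  forall t h, 0 < h -> (forall r : nat, kappa * t%:R <= r%:R -> eta r <= h) ->
    sq_error t.+1 <= (1 - 2 * (mu - delta) * eta t) * sq_error t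
      + K * (eta t * h + eta t * h ^+ 2 + eta t * q t ^+ 2 + eta t ^+ 2).
Proof.
move=> delta0; have nR : 0 < n%:R :> R by rewrite ltr0n.
(* Each agent loses eps/2 to staleness and eps/2 to bias, in total n eps = delta. *)
pose eps := delta / n%:R; have eps0 : 0 < eps by rewrite divr_gt0.
have epsE : n%:R * eps = delta by rewrite mulrC divfK// gt_eqF.
have C0 := delay_C_gt0 delays; have G0 := G_ge0.
pose K1 := 4 * (n%:R ^+ 2 * (C + 1) * G).
pose K2 := n%:R * (eps^-1 * (L ^+ 2 * (C * (n%:R ^+ 2 * G)))).
pose K3 := n%:R * eps^-1.
pose K4 := n%:R ^+ 2 * G.
have K10 : 0 <= K1.
  by rewrite /K1 mulr_ge0// mulr_ge0// mulr_ge0 ?sqr_ge0// addr_ge0// ltW.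
have K20 : 0 <= K2.
  rewrite /K2 mulr_ge0// mulr_ge0 ?invr_ge0 ?(ltW eps0)// mulr_ge0 ?sqr_ge0//.
  by rewrite mulr_ge0 ?(ltW C0)// mulr_ge0 ?sqr_ge0.
have K30 : 0 <= K3 by rewrite mulr_ge0// invr_ge0 ltW.
have K40 : 0 <= K4 by rewrite mulr_ge0 ?sqr_ge0.
exists (K1 + K2 + K3 + K4); first by rewrite !addr_ge0.
move=> t h h0 hr.
have hD := vsqint_error t; have hV := vsqint_server t.
have e0 := eta_gt0 t.
have step : sq_error t.+1 <= sq_error t
    - 2 * eta t * \int[P]_w dot (server t w) (x t w - xs)
    + eta t ^+ 2 * \int[P]_w dot (server t w) (server t w).
  rewrite -!RintZ; try exact: summable_dot.
  have s1 := summable_dot _ _ _ hD hD.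
  have s2 := summableZ _ (2 * eta t) _ (summable_dot _ _ _ hV hD).
  have s3 := summableZ _ (eta t ^+ 2) _ (summable_dot _ _ _ hV hV).
  rewrite -RintB// -RintD//; last exact: summableB.
  apply: le_Rint.
  - by apply: summable_dot; exact: vsqint_error.
  - by apply: summableD => //; exact: summableB.
  - apply: nearW => w; apply: (le_trans (dot_step_le t w)).
    move: (x t w - xs) (server t w) => u v.
    rewrite dotBl !dotBr !dotZl !dotZr (dotC u v) le_eqVlt; apply/orP; left.
    by apply/eqP; ring.
have hserver : \int[P]_w dot (server t w) (x t w - xs) =
    \sum_i \int[P]_w dot (stale_estimate g xi tau x i t w) (x t w - xs).
  under eq_Rintegral do rewrite dot_suml.
  by rewrite Rint_sum// => i; apply: summable_dot => //; exact: vsqint_stale.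
have hstale : \sum_i \int[P]_w dot (gtilde i t w) (x t w - xs)
    - n%:R * (2 * ((C + 1) * h * n%:R * G)
      + (eps * sq_error t + eps^-1 * (L ^+ 2 * (C * h ^+ 2 * (n%:R ^+ 2 * G)))) / 2)
    <= \int[P]_w dot (server t w) (x t w - xs).
  rewrite hserver.
  apply: le_trans (ler_sum _ (fun i _ => Rint_stale_error_ge i t h eps h0 eps0 hr)).
  have sc (c : R) : \sum_(i < n) c = n%:R * c by rewrite sumr_const card_ord mulr_natl.
  rewrite !sumrB !sc -/(sq_error t).
  by rewrite le_eqVlt; apply/orP; left; apply/eqP; ring.
have hgt := Rint_gtilde_error_ge t eps eps0; rewrite -/(sq_error t) in hgt.
apply: (recursion_step _ _ _ _ _ _ _ _ _ _ _ _ _ (ltW e0) (ltW h0) K10 K20 K30 K40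
  step (Rint_server_le t)).
apply: le_trans (le_trans (lerD hgt (lexx _)) hstale).
rewrite le_eqVlt; apply/orP; left; apply/eqP; rewrite -epsE /K1 /K2 /K3; field.
by rewrite gt_eqF.
Qed.

End history.

Theorem theorem7 (R : realType) (d n : nat) (n_gt0 : (0 < n)%N)
    (dT : measure_display) (T : measurableType dT) (P : probability T R)
    (dX : measure_display) (Xi : measurableType dX)
    (S : set 'rV[R]_d) (S_closed : closed S) (S_convex : convex_set S)
    (f : 'I_n -> 'rV[R]_d -> R) (df : 'I_n -> 'rV[R]_d -> 'rV[R]_d)
    (g : 'I_n -> 'rV[R]_d -> Xi -> 'rV[R]_d)
    (xi : nat -> T -> Xi) (tau : 'I_n -> nat -> T -> int)
    (x : nat -> T -> 'rV[R]_d) (gtilde : 'I_n -> nat -> T -> 'rV[R]_d)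
    (eta q : nat -> R) (x0 xs : 'rV[R]_d) (L G C kappa mu : R)
    (x0_in : S x0) (eta_gt0 : forall t, 0 < eta t)
    (process : delayed_projected_sgd P S g xi tau x eta x0)
    (objective : objective_assumption S f df L)
    (estimators : estimator_assumption P g xi x df L G gtilde q)
    (delays : delay_assumption P xi tau C kappa)
    (mu_gt0 : 0 < mu)
    (f_strongly_convex :
      strongly_convex_on S mu (total_obj f) (total_grad df))
    (xs_argmin : is_argmin S (total_obj f) xs) :
  ((forall etabar : R,
      nonincreasing_seq eta ->
      0 < etabar ->
      eta `|Num.ceil (kappa * t%:R)|%N / eta t @[t --> \oo] --> etabar ->
      (\sum_(0 <= t <oo) (eta t)%:E = +oo)%E ->
      (\sum_(0 <= t <oo) (eta t ^+ 2)%:E < +oo)%E ->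
      (\sum_(0 <= t <oo) (eta t * q t ^+ 2)%:E < +oo)%E ->
      mean_sq_error P x xs t @[t --> \oo] --> 0%E)
   /\
   (forall eta0 q0 beta : R,
      (2 * mu)^-1 < eta0 ->
      0 < q0 ->
      2^-1 <= beta ->
      (forall t, eta t = eta0 / t.+1%:R) ->
      (forall t, q t = q0 / t.+1%:R `^ beta) ->
      exists K : R, \forall t \near \oo,
        (mean_sq_error P x xs t <= (K / t%:R)%:E)%E)).
Proof.
have /andP[kappa0 kappa1] := delay_kappa delays.
pose sqe := sq_error P x xs.
have msE t : mean_sq_error P x xs t = (sqe t)%:E.
  exact: (mean_sq_errorE P S S_closed S_convex g xi tau x eta x0 C kappa
    x0_in process delays f df gtilde q xs L G estimators xs_argmin t).
have sqe_rec := sq_error_recursion P S S_closed S_convex g xi tau x eta x0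
  C kappa x0_in process delays f df gtilde q xs L G mu n_gt0 eta_gt0 objective
  estimators mu_gt0 f_strongly_convex xs_argmin.
have sqe0 t : 0 <= sqe t by exact: sq_error_ge0.
split.
- move=> etabar eta_noninc etabar0 eta_lim sum_eta sum_eta2 sum_etaq.
  (* This margin leaves the contraction factor 1 - mu eta(t). *)
  have [K K0 rec] := sqe_rec (mu / 2) (divr_gt0 mu_gt0 (ltr0Sn R 1)).
  pose h t := eta `|Num.ceil (kappa * t%:R)|%N.
  have hh t (r : nat) : kappa * t%:R <= r%:R -> eta r <= h t.
    move=> hr; apply: eta_noninc.
    have : Num.ceil (kappa * t%:R) <= r%:Z by rewrite ceil_le_int.
    have : 0 <= Num.ceil (kappa * t%:R).
      by rewrite ceil_ge0 (lt_le_trans (ltrN10 R))// mulr_ge0// ltW.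
    by case: (Num.ceil _).
  pose m := etabar + 1.
  have [N _ hN] : \forall t \near \oo, h t / eta t < m.
    by apply: (cvgr_lt etabar eta_lim); rewrite /m ltrDl.
  (* Eventually h <= m eta(t), so eta h <= m eta^2 and, as eta(t) <= eta(0), eta h^2 <= m^2 eta(0)
     eta^2; the 1 accounts for the eta^2 already present. *)
  pose e t := K * ((m + m ^+ 2 * eta 0%N + 1) * eta t ^+ 2 + eta t * q t ^+ 2).
  have k0 : 0 <= m + m ^+ 2 * eta 0%N + 1.
    by rewrite addr_ge0// addr_ge0 ?mulr_ge0 ?sqr_ge0 ?(ltW (eta_gt0 _))// addr_ge0// ltW.
  have eta20 t : 0 <= eta t ^+ 2 by exact: sqr_ge0.
  have etaq0 t : 0 <= eta t * q t ^+ 2 by rewrite mulr_ge0 ?sqr_ge0 ?(ltW (eta_gt0 _)).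
  have [M1 hM1] := bounded_nneseries _ eta20 sum_eta2.
  have [M2 hM2] := bounded_nneseries _ etaq0 sum_etaq.
  have cvg0 : sqe @ \oo --> (0 : R).
    apply: (@recursion_shift_cvg0 _ sqe eta e mu
      (K * ((m + m ^+ 2 * eta 0%N + 1) * M1 + M2)) N) => //.
    + by move=> t; exact: ltW.
    + by move=> t; rewrite mulr_ge0// addr_ge0// mulr_ge0.
    + move=> t Nt; have et0 := eta_gt0 t.
      apply: (le_trans (rec t (h t) (eta_gt0 _) (hh t))).
      rewrite (_ : 2 * (mu - mu / 2) = mu); last by field.
      rewrite lerD2l /e ler_wpM2l//.
      have hm : h t <= m * eta t by rewrite -ler_pdivrMr// ltW//; exact: hN.
      have h0 : 0 <= h t by exact: ltW (eta_gt0 _).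
      have e1 : eta t * h t <= m * eta t ^+ 2.
        by rewrite expr2 mulrCA ler_wpM2l// ltW.
      have e2 : eta t * h t ^+ 2 <= m ^+ 2 * eta 0%N * eta t ^+ 2.
        apply: (@le_trans _ _ (eta 0%N * (m * eta t) ^+ 2)).
          apply: ler_pM; rewrite ?sqr_ge0 ?(ltW et0)//; first exact: eta_noninc.
          by rewrite lerXn2r ?nnegrE// (le_trans h0).
        by rewrite exprMn mulrCA mulrA.
      move: e1 e2; rewrite !mulrDl mul1r.
      move: (eta t * h t) (m * eta t ^+ 2) => y1 z1.
      move: (eta t * h t ^+ 2) (m ^+ 2 * eta 0%N * eta t ^+ 2) => y2 z2 e1 e2.
      by rewrite addrAC lerD2r lerD2r lerD.
    + move=> t; rewrite /e -mulr_sumr ler_wpM2l// big_split/= -mulr_sumr.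
      by apply: lerD => //; rewrite ler_wpM2l.
    + by move=> B; apply: unbounded_nneseries => // t; exact: ltW.
  rewrite (_ : (fun t => mean_sq_error P x xs t) = EFin \o sqe); last exact/funext.
  by apply: cvg_EFin => //; exact: nearW.
- move=> eta0 q0 beta eta0_gt q0_gt0 beta_ge etaE qE.
  have eta00 : 0 < eta0 by apply: lt_trans eta0_gt; rewrite invr_gt0 mulr_gt0.
  have h1 : 1 < 2 * mu * eta0.
    by rewrite -ltr_pdivrMl ?mulr_gt0// mulr1.
  (* Chosen so that p = 2 (mu - delta) eta0 is the midpoint of 1 and 2 mu eta0, hence above 1. *)
  pose delta := (2 * mu * eta0 - 1) / (4 * eta0).
  have delta0 : 0 < delta by rewrite divr_gt0 ?mulr_gt0 ?subr_gt0.
  have [K K0 rec] := sqe_rec delta delta0.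
  pose K' := K * (eta0 ^+ 2 / kappa + eta0 ^+ 3 / kappa ^+ 2 + eta0 * q0 ^+ 2 + eta0 ^+ 2).
  have eq0 : 0 <= eta0 * q0 ^+ 2 by apply: mulr_ge0; [exact: ltW|exact: sqr_ge0].
  have [||t|t|K2 hK2] := @recursion_rate _ sqe (2 * (mu - delta) * eta0) K'.
  + rewrite (_ : _ * eta0 = (2 * mu * eta0 + 1) / 2); first lra.
    by rewrite /delta; field; rewrite gt_eqF.
  + rewrite /K' mulr_ge0// addr_ge0 ?sqr_ge0// addr_ge0// addr_ge0//.
      by rewrite divr_ge0 ?sqr_ge0// ltW.
    by rewrite divr_ge0 ?sqr_ge0// exprn_ge0// ltW.
  + exact: sqe0.
  + have t0 : 0 < t.+1%:R :> R by rewrite ltr0n.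
    have t1 : 1 <= t.+1%:R :> R by rewrite ler1n.
    (* From r >= kappa t and kappa < 1 follows r + 1 >= kappa (t + 1), so this value bounds
       eta(r). *)
    have ht0 : 0 < eta0 / (kappa * t.+1%:R) by rewrite divr_gt0 ?mulr_gt0.
    have ht (r : nat) : kappa * t%:R <= r%:R -> eta r <= eta0 / (kappa * t.+1%:R).
      move=> hr; rewrite etaE ler_wpM2l ?(ltW eta00)// lef_pV2 ?posrE ?mulr_gt0//.
      by rewrite -!natr1 mulrDr mulr1 lerD// ltW.
    apply: (le_trans (rec t _ ht0 ht)); rewrite etaE qE -/(sqe t).
    rewrite (_ : 2 * (mu - delta) * (eta0 / t.+1%:R) = 2 * (mu - delta) * eta0 / t.+1%:R);
      last by rewrite mulrA.
    rewrite lerD2l (_ : K' / _ = K * ((eta0 ^+ 2 / kappa + eta0 ^+ 3 / kappa ^+ 2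
      + eta0 * q0 ^+ 2 + eta0 ^+ 2) / t.+1%:R ^+ 2)); last by rewrite mulrA.
    rewrite ler_wpM2l//.
    set y : R := t.+1%:R in t0 t1 *.
    (* Since y >= 1 and beta >= 1/2, q^2 decays at least like 1/y, which gives eta q^2 the order
       1/y^2. *)
    have hpow : y <= (y `^ beta) ^+ 2.
      have : y `^ 2^-1 <= y `^ beta by rewrite ler_powR.
      rewrite powR12_sqrt ?(ltW t0)// => hs.
      rewrite -[leLHS]sqr_sqrtr ?(ltW t0)// lerXn2r ?nnegrE ?sqrtr_ge0 ?powR_ge0//.
    have p0 : 0 < (y `^ beta) ^+ 2 by apply: lt_le_trans hpow.
    have a1 : eta0 / y * (eta0 / (kappa * y)) = eta0 ^+ 2 / kappa / y ^+ 2.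
      by field; rewrite !gt_eqF.
    (* This term has order 1/y^3; the spare factor 1/y is at most 1. *)
    have a2 : eta0 / y * (eta0 / (kappa * y)) ^+ 2 <= eta0 ^+ 3 / kappa ^+ 2 / y ^+ 2.
      rewrite (_ : eta0 / y * _ = eta0 ^+ 3 / kappa ^+ 2 / y ^+ 2 * y^-1); last first.
        by field; rewrite !gt_eqF.
      rewrite ler_piMr ?invf_le1// divr_ge0 ?sqr_ge0// divr_ge0 ?sqr_ge0//.
      by rewrite exprn_ge0 ?ltW.
    have a3 : eta0 / y * (q0 / y `^ beta) ^+ 2 <= eta0 * q0 ^+ 2 / y ^+ 2.
      rewrite expr_div_n mulf_div ler_wpM2l//.
      rewrite lef_pV2 ?posrE ?exprn_gt0//; last exact: mulr_gt0.
      by rewrite [leLHS]expr2 ler_wpM2l ?(ltW t0).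
    have a4 : (eta0 / y) ^+ 2 = eta0 ^+ 2 / y ^+ 2 by rewrite expr_div_n.
    by rewrite !mulrDl a1 a4 lerD2r; apply: lerD => //; rewrite lerD2l.
  exists K2; apply: filterS hK2 => t ht.
  by rewrite msE lee_fin.
Qed.
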